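(* Assume that $S$ restricts to a $C_0$-semigroup $S_H$ on $H$. Then: (1) for all $t,s>0$ we have $H_t=H_s$ with equivalent norms; (2) for all $t>0$ we have $H_t\subseteq H$ with dense inclusion; (3) for all $t>0$ we have $S(t)H\subseteq H_t$ and $$\limsup_{t\downarrow0}\sqrt t\,\|S(t)\|_{\mathcal L(H,H_t)}\le\limsup_{t\downarrow0}\|S_H(t)\|_H.$$
   Context: $E$ is a real Banach space with dual $E^*$; $S=\{S(t)\}_{t\ge0}$ is a $C_0$-semigroup of bounded linear operators on $E$ with adjoint operators $S^*(t)$ on $E^*$. $H$ is a real Hilbert space with a continuous injective linear map $i:H\to E$; $H$ is identified with its image in $E$, and $Q:=i\circ i^*\in\mathcal L(E^*,E)$ ($H$ being identified with its dual). For $t>0$, $Q_t x^*:=\int_0^t S(s)QS^*(s)x^*\,ds$ for $x^*\in E^*$. ''$S$ restricts to a $C_0$-semigroup $S_H$ on $H$'' means that $S(t)H\subseteq H$ for all $t\ge0$ and the restrictions $S_H(t)=S(t)|_H$ form a $C_0$-semigroup on $H$; $\|S_H(t)\|_H$ is the operator norm on $H$. An operator $R\in\mathcal L(E^*,E)$ is positive if $\langle Rx^*,x^*\rangle\ge0$ and symmetric if $\langle Rx^*,y^*\rangle=\langle Ry^*,x^*\rangle$ for all $x^*,y^*\in E^*$. For such $R$, its reproducing kernel Hilbert space (RKHS) is the completion $H_R$ of the range of $R$ for the inner product $(Rx^*,Ry^* )\mapsto\langle Rx^*,y^*\rangle$; the inclusion of the range of $R$ in $E$ extends to a continuous injection $i_R:H_R\to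 E$ with $R=i_R\circ i_R^*$, and $H_R$ is identified with its image in $E$. $H_t$ is the RKHS of $Q_t$. $\|S(t)\|_{\mathcal L(H,H_t)}$ is the norm of $S(t)$ viewed as an operator from $H$ to $H_t$. *)

(* Defs.v *)
From HB Require Import structures.
From mathcomp Require Import all_boot all_order all_algebra.
From mathcomp Require Import all_classical all_reals all_analysis.

Set Implicit Arguments.
Unset Strict Implicit.
Unset Printing Implicit Defensive.

Import Order.TTheory GRing.Theory Num.Theory.
Import numFieldNormedType.Exports.

Local Open Scope classical_set_scope.
Local Open Scope ring_scope.

HB.structure Definition LinearContinuous (R : numFieldType)
    (E F : normedModType R) :=
  {f of @GRing.Linear R E F *:%R f & @isContinuous E F f}.

Notation "{ 'linear_continuous' E -> F }" := (@LinearContinuous.type _ E F)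
  (at level 0, E at level 98, F at level 99,
   format "{ 'linear_continuous'  E  ->  F }") : type_scope.

HB.instance Definition _ (R : numFieldType) (E F G : normedModType R)
    (f : {linear_continuous E -> F}) (g : {linear_continuous F -> G}) :=
  Continuous.on (g \o f : E -> G).

Definition dual_space (R : numFieldType) (E : normedModType R) :=
  {linear_continuous E -> R^o}.

Definition adjoint (R : numFieldType) (E F : normedModType R)
    (T : {linear_continuous E -> F}) (y : dual_space F) : dual_space E :=
  (y : {linear_continuous F -> R^o}) \o T.

(* Only the values at t >= 0 are constrained. *)
Definition C0_semigroup (R : realType) (E : normedModType R)
    (S : R -> {linear_continuous E -> E}) : Prop :=
  [/\ forall x, S 0 x = x,
      forall s t, 0 <= s -> 0 <= t -> forall x, S (s + t) x = S s (S t x) &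
      forall x, S t x @[t --> 0^'+] --> x].

(* H is seen inside E through i; as i is injective, SH t is the restriction
   of S t. *)
Definition restricts_to (R : realType) (E H : normedModType R)
    (i : {linear_continuous H -> E}) (S : R -> {linear_continuous E -> E})
    (SH : R -> {linear_continuous H -> H}) : Prop :=
  (forall t, 0 <= t -> forall h, i (SH t h) = S t (i h)) /\ C0_semigroup SH.

(* i^* : E^* -> H, with H^* identified with H by the Riesz theorem: i^* x is
   the vector representing the functional x \o i. *)
Definition hilbert_adjoint (R : realType) (H E : normedModType R)
    (dot : {dot H for idfun}) (i : {linear_continuous H -> E})
    (x : dual_space E) : H :=
  xget 0 [set h | forall k, dot h k = adjoint i x k].

Definition cov_operator (R : realType) (H E : normedModType R)
    (dot : {dot H for idfun}) (i : {linear_continuous H -> E})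
    (x : dual_space E) : E :=
  i (hilbert_adjoint dot i x).

Section bochner.
Context {R : realType} {E : normedModType R}.

Definition simple_map (g : R -> E) : Prop :=
  finite_set (range g) /\
  forall v, measurable (g @^-1` [set v] : set (measurableTypeR R)).

Definition simple_integral (t : R) (g : R -> E) : E :=
  \sum_(v \in range g)
    fine (lebesgue_measure (`[0, t] `&` g @^-1` [set v])) *: v.

(* The a.e. convergence is the strong measurability of f. *)
Definition is_bochner_integral (t : R) (f : R -> E) (v : E) : Prop :=
  exists g : nat -> R -> E,
    [/\ forall n, simple_map (g n),
        {ae lebesgue_measure, forall s : measurableTypeR R,
           s \in `[0, t] -> g n s @[n --> \oo] --> f s},
        (\int[lebesgue_measure]_(s in `[0%R, t]) (`|f s - g n s|%:E))%E
           @[n --> \oo] --> 0%E &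
        simple_integral t (g n) @[n --> \oo] --> v].

(* The Bochner integral of f over [0, t], 0 if f is not Bochner integrable. *)
Definition bochner_integral (t : R) (f : R -> E) : E :=
  xget 0 [set v | is_bochner_integral t f v].

End bochner.

(* Q_t. If S restricts to SH on H and Q = i i^*, the integrand at s is
   i (SH(s) SH(s)^* i^* x), which is continuous in s: the integral exists. *)
Definition integrated_covariance (R : realType) (E : normedModType R)
    (S : R -> {linear_continuous E -> E}) (Q : dual_space E -> E)
    (t : R) (x : dual_space E) : E :=
  bochner_integral t (fun s => S s (Q (adjoint (S s) x))).

(* The reproducing kernel Hilbert space of a positive symmetric operator
   A : E^* -> E, as a subset of E with a norm. An element of the completion of
   the range of A for (A x, A y) |-> <A x, y> is the class of a Cauchy sequence
   (A (u n))_n, and its image under i_A is the limit of this sequence in E. *)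
Section rkhs.
Context {R : realType} {E : normedModType R}.
Variable A : dual_space E -> E.

(* the norm of A x *)
Definition range_norm (x : dual_space E) : R := Num.sqrt (x (A x)).

(* the norm of A x - A y = A (x - y), whose square is <A x - A y, x - y> *)
Definition range_dist (x y : dual_space E) : R :=
  Num.sqrt (x (A x - A y) - y (A x - A y)).

Definition rkhs_rep (u : nat -> dual_space E) (z : E) : Prop :=
  (forall e, 0 < e -> \forall m & n \near \oo, range_dist (u m) (u n) < e) /\
  A (u n) @[n --> \oo] --> z.

Definition rkhs : set E := [set z | exists u, rkhs_rep u z].

(* By the injectivity of i_A, the limit below does not depend on the choice
   of u. The value of rkhs_norm outside rkhs is irrelevant. *)
Definition rkhs_norm (z : E) : R :=
  xget 0 [set r | exists2 u, rkhs_rep u z &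
                    range_norm (u n) @[n --> \oo] --> r].

End rkhs.

Definition equivalent_norms (R : realType) (T : Type) (D : set T)
    (N1 N2 : T -> R) : Prop :=
  exists c C : R, [/\ 0 < c, 0 < C &
    forall z, D z -> c * N1 z <= N2 z <= C * N1 z].

(* The norm of f for the norm N on its codomain, +oo if f is unbounded. *)
Definition operator_norm (R : realType) (H : normedModType R) (T : Type)
    (N : T -> R) (f : H -> T) : \bar R :=
  ereal_sup [set (N (f h))%:E | h in [set h : H | `|h| <= 1]].

(* Main.v *)
Require Import Defs.
From HB Require Import structures.
From mathcomp Require Import all_boot all_order all_algebra.
From mathcomp Require Import all_classical all_reals all_analysis.
From mathcomp Require Import measurable_realfun ring lra.

(** Everything is read off one family of quadratic forms on [H]. Write [T s] for
the adjoint of [SH s] and [j] for the adjoint of [i], from the dual of [E] to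
[H]. Since [S s \o i = i \o SH s], the integrand of [Q t x] at [s] is
[i (SH s (T s (j x)))], and testing against [y] gives
[y (Q t x) = gram t (j x) (j y)], where [gram t h k] is the integral over [0, t]
of the inner product of [T s h] and [T s k] ([dual_integrated_covariance]).

The integral exists because [T] is again strongly continuous
([adjoint_semigroup_C0]): the vectors on which it is contain the averages of
the orbits of [T], and nothing is orthogonal to all of these. The integral of a
continuous [H]-valued function is then constructed weakly by the Riesz theorem
and shown to be the limit of the integrals of simple functions
([bochner_exists]). The theorem of Hahn and Banach ([hahn_banach]) gives the
uniqueness of Bochner integrals in [E], and, [i] being injective, shows that
only [0] is orthogonal to the range of [j].

The RKHS of [Q t] is then the set of the [i h] such that, for some [C],
[|<h, k>| <= C * sqrt (gram t k k)] for all [k] in the range of [j], and its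
norm is the least such [C] ([rkhs_of_gram_dominated], [rkhs_norm_gram]): the
sequences that define it are the Cauchy sequences representing such a
functional, and these are obtained by minimising a quadratic functional
([semi_riesz_sequence]).

The three claims become statements on [gram].
- The forms [gram t] and [gram s] are comparable, because
  [T u = T (u - c * u) \o T (c * u)] for [0 <= c <= 1] and [T] is locally
  bounded ([gram_comparison]).
- If [l] is orthogonal to the RKHS of [Q t] then [gram t l l = 0], so that
  [T s l] vanishes on [0, t] by continuity, and [l = T 0 l = 0]
  ([rkhs_dense]).
- If [m] bounds [SH] on ]0, t], then [|T t k| <= m * |T s k|] for [s] in
  [0, t]; squaring and integrating in [s] gives [t * |T t k| ^+ 2 <=
  m ^+ 2 * gram t k k]. As [<SH t h, k> = <h, T t k>], this says that the norm
  of [S t] from [H] to the RKHS of [Q t] is at most [m / sqrt t]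
  ([semigroup_maps_into_rkhs]). *)

Set Implicit Arguments.
Unset Strict Implicit.
Unset Printing Implicit Defensive.

Import Order.TTheory GRing.Theory Num.Theory.
Import numFieldNormedType.Exports.

Local Open Scope classical_set_scope.
Local Open Scope ring_scope.

(** * Continuous linear maps and the Hahn-Banach theorem *)

Section bounded_linear_maps.
Context {R : realType}.

Lemma linear_continuous_of_bound (E F : normedModType R) (f : E -> F) (C : R) :
  linear f -> (forall x, `|f x| <= C * `|x|) ->
  exists T : {linear_continuous E -> F}, forall x, T x = f x.
Proof.
move=> lf bf.
pose flin : {linear E -> F} := HB.pack f (GRing.isLinear.Build _ _ _ _ _ lf).
have cf : continuous f.
  apply: (@bounded_linear_continuous _ _ _ flin).
  apply/linear_boundedP; exists C; split; first exact: num_real.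
  move=> r Cr x; apply: le_trans (bf x) _; apply: ler_wpM2r => //; exact: ltW.
pose T : {linear_continuous E -> F} :=
  HB.pack f (GRing.isLinear.Build _ _ _ _ _ lf) (isContinuous.Build _ _ f cf).
by exists T.
Qed.

Lemma linear_continuous_bound (E F : normedModType R)
    (T : {linear_continuous E -> F}) :
  exists2 C, 0 < C & forall x, `|T x| <= C * `|x|.
Proof.
have /linear_boundedP : bounded_near T (nbhs 0).
  by apply: continuous_linear_bounded; exact: cts_fun.
case=> C [_ CP]; exists (Num.max C 0 + 1).
  by rewrite ltr_wpDl// le_max lexx orbT.
by apply: CP; rewrite ltr_pwDr// le_max lexx.
Qed.

Lemma dual_lin (E : normedModType R) (x : dual_space E) a u v :
  x (a *: u + v) = a * x u + x v.
Proof. exact: linearP. Qed.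

Lemma dualB (E : normedModType R) (x : dual_space E) u v : x (u - v) = x u - x v.
Proof. exact: linearB. Qed.

End bounded_linear_maps.

Section hahn_banach.
Context {R : realType} {E : normedModType R}.
Implicit Types (A B : set (E * R)) (z : E).

(** Partial linear functionals are encoded by their graphs, so that the union of
a chain is an upper bound without any gluing of functions. Such a graph is
single-valued, by the bound applied to the points above [0]. The last clause is
conditional because the union of the empty chain is empty. *)
Definition dominated_graph z A :=
  [/\ forall a p q, A p -> A q -> A (a *: p.1 + q.1, a * p.2 + q.2),
      forall p, A p -> p.2 <= `|p.1| &
      A !=set0 -> A (z, `|z|)].

Lemma dominated_graph_bigcup z (F : set (set (E * R))) :
  F `<=` dominated_graph z -> total_on F subset ->
  dominated_graph z (\bigcup_(X in F) X).
Proof.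
move=> Fz Ftot; split.
- move=> a p q [X FX Xp] [Y FY Yq].
  have [XY|YX] := Ftot _ _ FX FY.
    by exists Y => //; have [+ _ _] := Fz _ FY; apply => //; exact: XY.
  by exists X => //; have [+ _ _] := Fz _ FX; apply => //; exact: YX.
- by move=> p [X FX Xp]; have [_ + _] := Fz _ FX; apply.
- move=> [p [X FX Xp]]; exists X => //.
  by have [_ _ +] := Fz _ FX; apply; exists p.
Qed.

Lemma dominated_graph_line z :
  dominated_graph z [set p | exists a, p = (a *: z, a * `|z|)].
Proof.
split.
- move=> a _ _ [b ->] [c ->]; exists (a * b + c) => /=.
  by rewrite scalerDl scalerA mulrDl mulrA.
- move=> _ [a ->] /=; rewrite normrZ ler_wpM2r//; exact: ler_norm.
- by move=> _; exists 1; rewrite scale1r mul1r.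
Qed.

(** The value [c] at the new vector [e] must be at least [r - |p - e|] and at most
[|p + e| - r] for all [(p, r)] in the graph. Every lower bound is below every
upper bound by the triangle inequality, so the supremum of the former works. *)
Lemma dominated_graph_extend z A (e : E) :
  dominated_graph z A -> A (z, `|z|) ->
  exists c, dominated_graph z
    [set p | exists t q, A q /\ p = (q.1 + t *: e, q.2 + t * c)].
Proof.
move=> [Alin Adom _] Az.
have A0 : A (0, 0).
  have := Alin (-1) _ _ Az Az => /=.
  by rewrite scaleN1r addNr mulN1r addNr.
have AZ a p : A p -> A (a *: p.1, a * p.2).
  by move=> Ap; have := Alin a _ _ Ap A0; rewrite /= !addr0.
have AD p q : A p -> A q -> A (p.1 + q.1, p.2 + q.2).
  by move=> Ap Aq; have := Alin 1 _ _ Ap Aq; rewrite /= scale1r mul1r.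
pose L := [set r | exists2 p, A p & r = p.2 - `|p.1 - e|].
have Lub p : A p -> ubound L (`|p.1 + e| - p.2).
  move=> Ap _ [q Aq ->]; rewrite lerBrDr addrAC lerBlDr.
  apply: le_trans (Adom _ (AD _ _ Aq Ap)) _ => /=.
  have -> : q.1 + p.1 = (p.1 + e) + (q.1 - e).
    by rewrite addrACA subrr addr0 addrC.
  exact: ler_normD.
have L0 : L !=set0 by exists (0 - `|0 - e|), (0, 0).
have Lsup : has_sup L by split=> //; exists (`|0 + e| - 0); exact: (Lub (0, 0)).
exists (sup L); split.
- move=> a _ _ [t [p [Ap ->]]] [s [q [Aq ->]]] /=.
  exists (a * t + s), (a *: p.1 + q.1, a * p.2 + q.2); split; first exact: Alin.
  congr (_, _) => /=.
    by rewrite scalerDr scalerDl scalerA addrACA.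
  by ring.
- move=> _ [t [p [Ap ->]]] /=.
  have [t0|t0|->] := ltgtP t 0; last first.
  + by rewrite scale0r mul0r !addr0; exact: Adom.
  + have := @sup_le_ub _ _ _ L0 (Lub _ (AZ t^-1 _ Ap)) => /=.
    have -> : t^-1 *: p.1 + e = t^-1 *: (p.1 + t *: e).
      by rewrite scalerDr scalerA mulVf ?gt_eqF// scale1r.
    rewrite normrZ gtr0_norm ?invr_gt0// -mulrBr mulrC ler_pdivlMr//.
    by rewrite lerBrDl mulrC.
  + have : L ((- t^-1) * p.2 - `|(- t^-1) *: p.1 - e|).
      by exists (- t^-1 *: p.1, - t^-1 * p.2) => //; exact: AZ.
    move=> /(ub_le_sup Lsup.2).
    have -> : (- t^-1) *: p.1 - e = (- t^-1) *: (p.1 + t *: e).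
      by rewrite scalerDr scalerA mulNr mulVf ?lt_eqF// scaleN1r.
    have t'0 : 0 < - t^-1 by rewrite oppr_gt0 invr_lt0.
    rewrite normrZ gtr0_norm// -mulrBr.
    have -> : - t^-1 = (- t)^-1 by rewrite invrN.
    by rewrite mulrC ler_pdivrMr ?oppr_gt0//; lra.
- move=> _; exists 0, (z, `|z|); split=> //=.
  by rewrite scale0r mul0r !addr0.
Qed.

(** A maximal dominated graph contains a pair above every vector, since it could
be extended otherwise; it is therefore the graph of a functional. *)
Lemma hahn_banach z : exists2 y : dual_space E, y z = `|z| &
  forall x, `|y x| <= `|x|.
Proof.
have [A [Az Amax]] := Zorn_bigcup (@dominated_graph_bigcup z).
have [Alin Adom Az0] := Az.
have Azz : A (z, `|z|).
  apply: Az0; apply/set0P/eqP => A0.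
  apply: (Amax _ _ (dominated_graph_line z)); rewrite A0; split; first exact: sub0set.
  by move=> /(_ (1 *: z, 1 * `|z|)); apply; exists 1.
have Atot e : exists r, A (e, r).
  have [c cP] := dominated_graph_extend e Az Azz.
  apply: contrapT => /forallNP nA; apply: Amax cP; split.
    by move=> [p r] Apr; exists 0, (p, r); split=> //=; rewrite scale0r mul0r !addr0.
  have A0 : A (0, 0).
    have := Alin (-1) _ _ Azz Azz => /=.
    by rewrite scaleN1r addNr mulN1r addNr.
  move=> H; apply: (nA c); apply: H; exists 1, (0, 0).
  by split=> //=; rewrite scale1r mul1r !add0r.
have Afun e r s : A (e, r) -> A (e, s) -> r = s.
  suff H r' s' : A (e, r') -> A (e, s') -> r' <= s'.
    by move=> Ar As; apply/eqP; rewrite eq_le !H.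
  move=> Ar As; have := Alin (-1) _ _ As Ar => /=.
  rewrite scaleN1r addNr mulN1r => /Adom /=; rewrite normr0; lra.
have [f fP] := choice Atot.
have flin : linear f.
  by move=> a x y; apply: Afun (fP _) _; exact: Alin (fP x) (fP y).
have fle x : `|f x| <= 1 * `|x|.
  rewrite mul1r ler_norml; apply/andP; split; last exact: Adom (fP x).
  have f0 : f 0 = 0.
    by have := flin (-1) 0 0; rewrite scaleN1r oppr0 addr0 scaleN1r addNr.
  have := flin (-1) x 0; rewrite scaleN1r addr0 scaleN1r f0 addr0 => fN.
  by rewrite lerNl -fN -(normrN x); exact: (Adom _ (fP (- x))).
have [y yP] := @linear_continuous_of_bound R E R^o f 1 flin fle.
exists y => [|x]; rewrite yP; first exact: Afun (fP z) Azz.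
by rewrite -[leRHS]mul1r.
Qed.

Lemma dual_separates (v w : E) :
  (forall y : dual_space E, y v = y w) -> v = w.
Proof.
move=> vw; have [y yvw _] := hahn_banach (v - w).
by apply/eqP; rewrite -subr_eq0 -normr_eq0 -yvw raddfB /= vw subrr.
Qed.

End hahn_banach.

(** * Semi-inner products *)

Section sequences.
Context {R : realType}.

Lemma cauchy_seq_cvg (V : completeNormedModType R) (u : nat -> V) :
  (forall e, 0 < e -> \forall m & n \near \oo, `|u m - u n| < e) -> cvgn u.
Proof.
move=> uC; apply/cauchy_cvgP/cauchy_ballP => e e0.
have [[A B] /= [A0 B0] AB] := uC _ e0.
exists (u @` A, u @` B) => /=.
  by split; [apply: filterS A0|apply: filterS B0] => n ?; exists n.
move=> [_ _] [/= [m Am <-] [n Bn <-]].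
by rewrite -ball_normE /=; exact: (AB (m, n)).
Qed.

Lemma cvg_le_bound (V : normedModType R) (T : Type) (F : set_system T)
    {FF : Filter F} (u : T -> V) l (v : T -> R) :
  (\forall x \near F, `|u x - l| <= v x) -> v @ F --> 0 -> u @ F --> l.
Proof.
move=> uv /cvgr0Pnorm_le v0; apply/cvgrPdist_le => e e0.
apply: filterS2 uv (v0 _ e0) => x uv vx.
by rewrite distrC; apply: le_trans uv (le_trans (ler_norm _) vx).
Qed.

Lemma discriminant_le (p q r : R) : 0 <= p ->
  (forall a, 0 <= p * a ^+ 2 + 2 * q * a + r) -> q ^+ 2 <= p * r.
Proof.
rewrite le_eqVlt => /predU1P[<-|p0] H.
  rewrite mul0r; have [->|q0] := eqVneq q 0; first by rewrite expr0n.
  have := H (- (r + 1) / (2 * q)).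
  have -> : 0 * (- (r + 1) / (2 * q)) ^+ 2 + 2 * q * (- (r + 1) / (2 * q)) + r = -1.
    by field.
  lra.
have := H (- q / p).
have -> : p * (- q / p) ^+ 2 + 2 * q * (- q / p) + r = r - q ^+ 2 / p.
  by field; rewrite gt_eqF.
by rewrite subr_ge0 ler_pdivrMr// mulrC.
Qed.

End sequences.

Section semi_inner_product.
Context {R : realType} {V : lmodType R}.
Implicit Types (b : V -> V -> R) (l : V -> R) (D : set V).

Definition semi_inner b :=
  [/\ forall x y, b x y = b y x,
      forall a x y z, b (a *: x + y) z = a * b x z + b y z &
      forall x, 0 <= b x x].

Definition linear_subspace D :=
  D 0 /\ forall a x y, D x -> D y -> D (a *: x + y).

Definition seminorm_of b x := Num.sqrt (b x x).

Section theory.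
Variables (b : V -> V -> R).
Hypothesis b_semi : semi_inner b.
Local Notation "''N' x" := (seminorm_of b x) (at level 8, x at level 2).

Lemma semiC x y : b x y = b y x. Proof. by case: b_semi. Qed.
Lemma semi_ge0 x : 0 <= b x x. Proof. by case: b_semi. Qed.
Lemma semiPl a x y z : b (a *: x + y) z = a * b x z + b y z.
Proof. by case: b_semi. Qed.
Lemma semi0l z : b 0 z = 0.
Proof. by have := semiPl (-1) 0 0 z; rewrite scaleN1r addNr mulN1r addNr. Qed.
Lemma semiDl x y z : b (x + y) z = b x z + b y z.
Proof. by rewrite -[x]scale1r semiPl mul1r scale1r. Qed.
Lemma semiZl a x z : b (a *: x) z = a * b x z.
Proof. by rewrite -[a *: x]addr0 semiPl semi0l addr0. Qed.
Lemma semiNl x z : b (- x) z = - b x z.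
Proof. by rewrite -scaleN1r semiZl mulN1r. Qed.
Lemma semiBl x y z : b (x - y) z = b x z - b y z.
Proof. by rewrite semiDl semiNl. Qed.
Lemma semiDr x y z : b x (y + z) = b x y + b x z.
Proof. by rewrite semiC semiDl !(semiC _ x). Qed.
Lemma semiZr a x z : b x (a *: z) = a * b x z.
Proof. by rewrite semiC semiZl (semiC _ x). Qed.
Lemma semiNr x z : b x (- z) = - b x z.
Proof. by rewrite semiC semiNl (semiC _ x). Qed.
Lemma semiBr x y z : b x (y - z) = b x y - b x z.
Proof. by rewrite semiDr semiNr. Qed.

Lemma seminorm_ge0 x : 0 <= 'N x. Proof. exact: sqrtr_ge0. Qed.
Lemma seminorm_sqr x : 'N x ^+ 2 = b x x.
Proof. by rewrite sqr_sqrtr// semi_ge0. Qed.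
Lemma seminormN x : 'N (- x) = 'N x.
Proof. by rewrite /seminorm_of semiNl semiNr opprK. Qed.

Lemma cauchy_schwarz x y : `|b x y| <= 'N x * 'N y.
Proof.
rewrite -ler_sqr ?nnegrE ?mulr_ge0 ?seminorm_ge0// exprMn !seminorm_sqr.
rewrite real_normK ?num_real//; apply: discriminant_le; first exact: semi_ge0.
move=> a; have := semi_ge0 (a *: x + y).
rewrite semiPl semiDr semiDr !semiZr (semiC y x); congr (0 <= _); ring.
Qed.

Lemma seminorm_triangle x y : 'N (x + y) <= 'N x + 'N y.
Proof.
rewrite -ler_sqr ?nnegrE ?addr_ge0 ?seminorm_ge0//.
rewrite sqrrD !seminorm_sqr semiDl !semiDr (semiC y x).
have := le_trans (ler_norm _) (cauchy_schwarz x y); lra.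
Qed.

Lemma seminorm_dist x y : `|'N x - 'N y| <= 'N (x - y).
Proof.
have H u v : 'N u - 'N v <= 'N (u - v).
  by rewrite lerBlDr; have := seminorm_triangle (u - v) v; rewrite subrK.
have := H y x; rewrite -(opprB x y) seminormN ler_norml H andbT; lra.
Qed.

Lemma semi_parallelogram x y :
  b (x - y) (x - y) = 2 * b x x + 2 * b y y - 4 * b (2^-1 *: (x + y)) (2^-1 *: (x + y)).
Proof.
by rewrite semiZl semiZr !semiBl !semiBr !semiDl !semiDr (semiC y x); field.
Qed.

Definition semi_cauchy (u : nat -> V) :=
  forall e, 0 < e -> \forall m & n \near \oo, 'N (u m - u n) < e.

(** The representing vector of [l] lives in the completion of [D] for [b], and is
given here by a Cauchy sequence: one that minimises [b x x - 2 * l x] on [D].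
Stated with sequences, the lemma serves both for the inner product of a Hilbert
space (Riesz theorem, density) and for the possibly degenerate forms that define
reproducing kernel Hilbert spaces. *)
Lemma semi_riesz_sequence D l (C : R) : linear_subspace D ->
  (forall a x y, l (a *: x + y) = a * l x + l y) ->
  (forall x, D x -> `|l x| <= C * 'N x) ->
  exists u : nat -> V, [/\ forall n, D (u n), semi_cauchy u &
    forall x, D x -> b (u n) x @[n --> \oo] --> l x].
Proof.
move=> [D0 Dlin] llin lC.
have DD x y : D x -> D y -> D (x + y).
  by move=> Dx Dy; rewrite -[x]scale1r; exact: Dlin.
have DZ a x : D x -> D (a *: x).
  by move=> Dx; rewrite -[_ *: _]addr0; exact: Dlin.
pose J x := b x x - 2 * l x.
have Jinf : has_inf (J @` D).
  split; first by exists (J 0), 0.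
  exists (- C ^+ 2) => _ [x Dx <-].
  rewrite /J -seminorm_sqr.
  have := le_trans (ler_norm _) (lC _ Dx).
  have : 0 <= ('N x - C) ^+ 2 by exact: sqr_ge0.
  rewrite sqrrB; lra.
pose m := inf (J @` D).
have mJ x : D x -> m <= J x by move=> Dx; apply: (ge_inf Jinf.2); exists x.
have /choice[u uP] (n : nat) : exists x, D x /\ J x < m + n.+1%:R^-1.
  have [_ [x Dx <-] xm] := @inf_adherent _ (J @` D) n.+1%:R^-1 ltac:(by rewrite invr_gt0) Jinf.
  by exists x.
exists u; split=> [n|e e0|x Dx]; first by case: (uP n).
- have e20 : 0 < e ^+ 2 / 4 by rewrite divr_gt0// exprn_gt0.
  have [N _ NP] : \forall n \near \oo, (n.+1%:R^-1 : R) < e ^+ 2 / 4.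
    by have /cvgrPdist_lt/(_ _ e20) := @cvg_harmonic R; apply: filterS => n;
      rewrite /= sub0r normrN ger0_norm// invr_ge0.
  exists ([set n | (N <= n)%N], [set n | (N <= n)%N]) => /=.
    by split; exists N.
  move=> [p q] [/= /NP /= pe /NP /= qe].
  have [Dp Jp] := uP p; have [Dq Jq] := uP q.
  rewrite -(@ltr_pXn2r _ 2) ?nnegrE ?seminorm_ge0 ?(ltW e0)// seminorm_sqr.
  (* the midpoint of u p and u q cannot be much better than either of them *)
  have := mJ _ (DZ 2^-1 _ (DD _ _ Dp Dq)).
  have l2 : l (2^-1 *: (u p + u q)) = 2^-1 * (l (u p) + l (u q)).
    have l0 : l 0 = 0.
      by have := llin (-1) 0 0; rewrite scaleN1r addNr mulN1r addNr.
    have lD y z : l (y + z) = l y + l z by rewrite -[y]scale1r llin mul1r scale1r.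
    by rewrite -[_ *: _]addr0 llin l0 addr0 lD.
  have := semi_parallelogram (u p) (u q).
  move: Jp Jq pe qe; rewrite /J l2.
  move: (p.+1%:R^-1) (q.+1%:R^-1) => ip iq; lra.
- apply: (cvg_le_bound (v := fun n => 'N x * Num.sqrt n.+1%:R^-1)).
    apply: nearW => n.
    have [Dn Jn] := uP n.
    rewrite -ler_sqr ?nnegrE ?mulr_ge0 ?seminorm_ge0// exprMn seminorm_sqr.
    rewrite sqr_sqrtr ?invr_ge0// real_normK ?num_real//.
    apply: discriminant_le; first exact: semi_ge0.
    (* Minimality up to 1 / (n + 1) along the line u n + a x is a quadratic
       inequality in a. *)
    move=> a; have := mJ _ (Dlin a _ _ Dx Dn).
    rewrite /J semiPl semiDr semiDr !semiZr (semiC (u n) x) llin.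
    move: Jn; rewrite /J.
    move: (n.+1%:R^-1) => ip; lra.
  rewrite -[X in _ --> X](mulr0 ('N x)); apply: cvgMl_tmp.
  rewrite -[X in _ --> X]sqrtr0.
  apply: (@continuous_cvg nat R R \oo _ harmonic Num.sqrt 0); first exact: sqrt_continuous.
  exact: cvg_harmonic.
Qed.

(** The norm of the functional represented by [u] is the limit of the norms of
the [u n]. It is not larger than any other bound [C] of [l], because [l (u n)]
is close to [b (u n) (u n)]. *)
Lemma semi_cauchy_norm D l (u : nat -> V) :
  (forall n, D (u n)) -> semi_cauchy u ->
  (forall x, D x -> b (u n) x @[n --> \oo] --> l x) ->
  exists r : R, [/\ 'N (u n) @[n --> \oo] --> r, 0 <= r,
    forall x, D x -> `|l x| <= r * 'N x &
    forall C, 0 <= C -> (forall x, D x -> `|l x| <= C * 'N x) -> r <= C].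
Proof.
move=> uD uC ul.
have : cvgn (fun n => 'N (u n)).
  apply: (@cauchy_seq_cvg R) => e e0; have := uC _ e0.
  by apply: filterS => -[m n] /=; exact: le_lt_trans (seminorm_dist _ _).
move=> /cvg_ex[/= r ur]; exists r; split => //.
- apply: (ler_cvg_to (cvg_cst 0) ur).
  by apply: nearW => n; exact: seminorm_ge0.
- move=> x Dx; have /cvg_norm lx := ul _ Dx.
  apply: (ler_cvg_to lx (cvgMr_tmp ur)).
  by apply: nearW => n; exact: cauchy_schwarz.
- move=> C C0 lC; apply/ler_addgt0Pr => e e0.
  have [[A B] /= [A0 B0] AB] := uC _ e0.
  apply: (ler_cvg_to ur (cvg_cst (C + e))).
  apply: filterS B0 => n Bn.
  have [->|n0] := eqVneq ('N (u n)) 0; first by rewrite addr_ge0// ltW.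
  have np : 0 < 'N (u n) by rewrite lt_neqAle eq_sym n0 seminorm_ge0.
  rewrite -(ler_pM2r np).
  have : `|l (u n) - b (u n) (u n)| <= e * 'N (u n).
    have /cvg_norm H : (b (u m) (u n) - b (u n) (u n)) @[m --> \oo]
        --> l (u n) - b (u n) (u n).
      by apply: cvgB; [exact: ul|exact: cvg_cst].
    apply: (ler_cvg_to H (cvg_cst _)).
    apply: filterS A0 => m Am; rewrite /= -semiBl.
    apply: le_trans (cauchy_schwarz _ _) _; rewrite ler_wpM2r ?seminorm_ge0//.
    exact/ltW/(AB (m, n)).
  have := lC _ (uD n); rewrite !ler_norml -seminorm_sqr => /andP[_ l1] /andP[l2 _].
  rewrite -expr2; lra.
Qed.

End theory.
End semi_inner_product.

(** * Hilbert spaces *)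

Section hilbert_space.
Context {R : realType} {H : completeNormedModType R}.
Variable dot : {dot H for idfun}.
Hypothesis dotE : forall h : H, dot h h = `|h| ^+ 2.

Lemma dot_semi : semi_inner (dot : H -> H -> R).
Proof.
split=> [x y|a x y z|x].
- by rewrite hermC expr0 mul1r.
- by rewrite linearPl.
- by rewrite dotE sqr_ge0.
Qed.

Lemma dot_seminorm h : seminorm_of (dot : H -> H -> R) h = `|h|.
Proof. by rewrite /seminorm_of dotE sqrtr_sqr normr_id. Qed.

Lemma dot_le h k : `|dot h k| <= `|h| * `|k|.
Proof. by have := cauchy_schwarz dot_semi h k; rewrite !dot_seminorm. Qed.

Lemma dot_ext h k : (forall l, dot h l = dot k l) -> h = k.
Proof.
move=> hk; apply/eqP; rewrite -subr_eq0 -normr_eq0 -sqrf_eq0 -dotE.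
by rewrite (semiBl dot_semi) hk subrr.
Qed.

Lemma norm_le_dot h C : 0 <= C -> (forall k, dot h k <= C * `|k|) -> `|h| <= C.
Proof.
move=> C0 hC; have [->|h0] := eqVneq h 0; first by rewrite normr0.
by rewrite -(@ler_pM2r _ `|h|) ?normr_gt0// -expr2 -dotE.
Qed.

Lemma cvg_dot (T : Type) (F : set_system T) {FF : Filter F} (f g : T -> H) a c :
  f @ F --> a -> g @ F --> c -> (fun x => dot (f x) (g x)) @ F --> (dot a c : R).
Proof.
move=> fa gc.
apply: (cvg_le_bound
  (v := fun x => `|f x - a| * `|g x| + `|a| * `|g x - c|)).
  apply: nearW => x.
  have -> : dot (f x) (g x) - dot a c = dot (f x - a) (g x) + dot a (g x - c).
    by rewrite (semiBl dot_semi) (semiBr dot_semi); ring.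
  by apply: le_trans (ler_normD _ _) _; rewrite lerD ?dot_le.
have -> : (0 : R) = `|a - a| * `|c| + `|a| * `|c - c|.
  by rewrite !subrr normr0 mul0r mulr0 addr0.
apply: cvgD; apply: cvgM; try exact: cvg_cst; try exact: cvg_norm;
  by apply: cvg_norm; apply: cvgB => //; exact: cvg_cst.
Qed.

Lemma riesz_representation (f : H -> R) C : linear f ->
  (forall k, `|f k| <= C * `|k|) -> exists h, forall k, dot h k = f k.
Proof.
move=> flin fC.
have [||k _|u [_ uC ul]] := @semi_riesz_sequence _ _ _ dot_semi setT f C.
- by split.
- exact: flin.
- by rewrite dot_seminorm.
have : cvgn u.
  apply: cauchy_seq_cvg => e /uC.
  by apply: filterS => -[m n] /=; rewrite dot_seminorm.
move=> /cvg_ex[/= h uh]; exists h => k.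
have uhk : dot (u n) k @[n --> \oo] --> (dot h k : R).
  by apply: cvg_dot => //; exact: cvg_cst.
exact: (norm_cvg_unique uhk (ul k Logic.I)).
Qed.

(** A Cauchy sequence in [D] that represents the functional [dot h] on [D]
converges, and its limit differs from [h] by a vector orthogonal to [D]. *)
Lemma approx_of_trivial_orthogonal D : linear_subspace D ->
  (forall h, (forall k, D k -> dot h k = 0) -> h = 0) ->
  forall h e, 0 < e -> exists2 k, D k & `|h - k| < e.
Proof.
move=> Dsub Dorth h.
have [||k _|u [uD uC ul]] := @semi_riesz_sequence _ _ _ dot_semi D (dot h) `|h|.
- exact: Dsub.
- by move=> a x y; rewrite (semiDr dot_semi) (semiZr dot_semi).
- by rewrite dot_seminorm dot_le.
have : cvgn u.
  apply: cauchy_seq_cvg => e /uC.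
  by apply: filterS => -[m n] /=; rewrite dot_seminorm.
move=> /cvg_ex[/= g ug].
have gh : g = h.
  apply/eqP; rewrite -subr_eq0; apply/eqP; apply: Dorth => k Dk.
  rewrite (semiBl dot_semi); apply/eqP; rewrite subr_eq0; apply/eqP.
  have uhk : dot (u n) k @[n --> \oo] --> (dot g k : R).
    by apply: cvg_dot => //; exact: cvg_cst.
  exact: (norm_cvg_unique uhk (ul k Dk)).
move=> e e0; move: ug; rewrite gh => /cvgrPdist_lt/(_ _ e0)[N _ NP].
by exists (u N); [exact: uD | exact: (NP N (leqnn N))].
Qed.

Lemma dense_of_trivial_orthogonal D : linear_subspace D ->
  (forall h, (forall k, D k -> dot h k = 0) -> h = 0) -> dense D.
Proof.
move=> Dsub Dorth O [h Oh] oO.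
have /nbhs_ballP[e /= e0 eO] := open_nbhs_nbhs (conj oO Oh).
have [k Dk hk] := approx_of_trivial_orthogonal Dsub Dorth h e0.
exists k; split; last exact: Dk.
by apply: (eO k); rewrite -ball_normE.
Qed.

Lemma adjoint_operator (T : {linear_continuous H -> H}) :
  exists T' : {linear_continuous H -> H}, forall h k, dot (T' h) k = dot h (T k).
Proof.
have [C C0 TC] := linear_continuous_bound T.
have Tb h k : `|dot h (T k)| <= (`|h| * C) * `|k|.
  by rewrite -mulrA (le_trans (dot_le _ _))// ler_wpM2l.
have /choice[f fP] h : exists g, forall k, dot g k = dot h (T k).
  apply: riesz_representation (Tb h) => a x y.
  by rewrite linearP (semiDr dot_semi) (semiZr dot_semi).
have flin : linear f.
  move=> a x y; apply: dot_ext => k.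
  by rewrite (semiPl dot_semi) !fP (semiPl dot_semi).
have fC h : `|f h| <= C * `|h|.
  apply: norm_le_dot => [|k]; first by rewrite mulr_ge0// ltW.
  by rewrite fP (mulrC C); exact: le_trans (ler_norm _) (Tb _ _).
have [T' T'P] := linear_continuous_of_bound flin fC.
by exists T' => h k; rewrite T'P.
Qed.

End hilbert_space.

(** * Integrals of continuous real functions *)

Section integral_of_continuous.
Context {R : realType}.
Implicit Types (f g : R -> R) (a c t r : R).

Definition primitive f t := \int[lebesgue_measure]_(s in `[0, t]) f s.

Lemma continuous_itv_integrable f a c : continuous f ->
  lebesgue_measure.-integrable `[a, c] (EFin \o f).
Proof.
move=> cf; apply: continuous_compact_integrable; first exact: segment_compact.
exact: continuous_subspaceT.
Qed.
Hint Resolve continuous_itv_integrable : core.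

Lemma primitive_lin a f g t : continuous f -> continuous g ->
  primitive (fun s => a * f s + g s) t = a * primitive f t + primitive g t.
Proof.
move=> cf cg.
have caf : continuous (fun s => a * f s) by move=> x; apply: cvgMl_tmp; exact: cf.
rewrite /primitive RintegralD//; [|exact: continuous_itv_integrable..].
by rewrite RintegralZl//; exact: continuous_itv_integrable.
Qed.

Lemma le_primitive f g t : continuous f -> continuous g ->
  (forall s, 0 <= s <= t -> f s <= g s) -> primitive f t <= primitive g t.
Proof.
move=> cf cg fg; apply: le_Rintegral; [by []|exact: continuous_itv_integrable..|].
by move=> s /=; rewrite in_itv /=; exact: fg.
Qed.

Lemma eq_primitive f g t :
  (forall s, 0 <= s <= t -> f s = g s) -> primitive f t = primitive g t.
Proof.
by move=> fg; apply: eq_Rintegral => s; rewrite inE /= in_itv /=; exact: fg.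
Qed.

Lemma primitive0 f : primitive f 0 = 0.
Proof. by rewrite /primitive set_itv1 Rintegral_set1. Qed.

Lemma primitive_cst c t : 0 <= t -> primitive (cst c) t = c * t.
Proof.
move=> t0; rewrite /primitive Rintegral_cst//; congr (_ * _).
transitivity (fine (if (0%:E < t%:E)%E then t%:E - 0%:E else 0)%E).
  exact: (congr1 fine (lebesgue_measure_itv `[0, t])).
rewrite lte_fin.
move: t0; rewrite le_eqVlt => /predU1P[<-|->]; first by rewrite ltxx.
by rewrite -EFinD subr0.
Qed.

Lemma primitiveB f u t : continuous f -> 0 <= u <= t ->
  primitive f t - primitive f u = \int[lebesgue_measure]_(s in `[u, t]) f s.
Proof.
move=> cf /andP[u0 ut]; rewrite Rintegral_itvB ?bnd_simp//; last first.
  exact: continuous_itv_integrable.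
rewrite Rintegral_itv_obnd_cbnd//.
apply: integrableS (continuous_itv_integrable u t cf) => //.
exact: subset_itv_oc_cc.
Qed.

(** Translations ([c = 1]) serve the averages of orbits of a semigroup, and
scalings ([r = 0]) the comparison of integrals over [0, t] and [0, s]. *)
Lemma primitive_affine f c r t : continuous f -> 0 < c -> 0 <= r -> 0 <= t ->
  primitive (fun s => f (c * s + r)) t =
  c^-1 * (primitive f (c * t + r) - primitive f r).
Proof.
move=> cf c0 r0 t0.
pose F (s : R) : R := c * s + r.
have dF s : is_derive s (1 : R) F c.
  by apply: is_derive_eq; rewrite scaler1 addr0.
have F' : derive1 F = cst c.
  by apply/funext => s; rewrite derive1E derive_val.
have cF : continuous F by move=> s; exact/differentiable_continuous/derivable1_diffP.
have F0 : F 0 = r by rewrite /F mulr0 add0r.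
have subst : \int[lebesgue_measure]_(s in `[F 0, F t]) f s =
    \int[lebesgue_measure]_(s in `[0, t]) (f (F s) * c).
  rewrite /Rintegral (@integration_by_substitution_increasing _ F)//.
  - by rewrite F'.
  - by move=> x y _ _ xy; rewrite /F ltrD2r ltr_pM2l.
  - by move=> s _; rewrite F'; exact: cvg_cst.
  - by rewrite F'; exact: is_cvg_cst.
  - by rewrite F'; exact: is_cvg_cst.
  - split.
    + by move=> s _; exact: ex_derive.
    + by apply: cvg_at_right_filter; exact: cF.
    + by apply: cvg_at_left_filter; exact: cF.
  - exact: continuous_subspaceT.
rewrite primitiveB//; last by rewrite r0 lerDr mulr_ge0// ltW.
rewrite -/(F t) -[X in `[X, _]]F0 subst RintegralZr//; last first.
  by apply: continuous_itv_integrable => s; exact: continuous_comp (cF s) (cf _).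
by rewrite mulrC mulfK// gt_eqF.
Qed.

Lemma primitive_increment_le f (K : R) t r : continuous f -> 0 <= t -> 0 <= r ->
  (forall s, t <= s <= t + r -> `|f s| <= K) ->
  `|primitive f (t + r) - primitive f t| <= K * r.
Proof.
move=> cf t0 r0 fK.
have cg : continuous (fun s : R => f (1 * s + t)).
  move=> s; apply: (@continuous_comp _ _ _ (fun s : R => 1 * s + t) f); last exact: cf.
  by apply: cvgD; [exact: cvgMl_tmp|exact: cvg_cst].
have -> : primitive f (t + r) - primitive f t = primitive (fun s => f (1 * s + t)) r.
  by rewrite primitive_affine// invr1 !mul1r (addrC r).
have fK' s : 0 <= s <= r -> `|f (1 * s + t)| <= K.
  by rewrite mul1r => sr; apply: fK; lra.
rewrite ler_norml -mulNr -!(@primitive_cst _ r)//; apply/andP; split;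
  apply: le_primitive => //; try (by move=> ?; exact: cvg_cst);
  by move=> s /fK'; rewrite ler_norml => /andP[].
Qed.

Lemma primitive_ge0_continuous_eq0 f t : continuous f -> 0 < t ->
  (forall s, 0 <= f s) -> primitive f t = 0 -> f 0 = 0.
Proof.
move=> cf t0 f0 If0; apply: contrapT => /eqP f00.
have fp : 0 < f 0 by rewrite lt_neqAle eq_sym f00 f0.
have f20 : 0 < f 0 / 2 by rewrite divr_gt0.
have /cvgrPdist_lt/(_ _ f20)/nbhs_ballP[d /= d0 dP] := cf 0.
pose u := Num.min (d / 2) t.
have u0 : 0 < u by rewrite lt_min t0 divr_gt0.
have ut : u <= t by rewrite ge_min lexx orbT.
have ud : u < d.
  by rewrite gt_min ltr_pdivrMr// ltr_pMr// ltr1n.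
have : primitive (cst (f 0 / 2)) u <= primitive f u.
  apply: le_primitive => //; first by move=> ?; exact: cvg_cst.
  move=> s /andP[s0 su]; have := dP s.
  rewrite -ball_normE /= sub0r normrN ger0_norm// => /(_ (le_lt_trans su ud)).
  rewrite ltr_norml => /andP[_]; lra.
rewrite primitive_cst ?(ltW u0)//.
have : 0 <= primitive f t - primitive f u.
  by rewrite primitiveB ?(ltW u0)//; exact: Rintegral_ge0.
have : 0 < f 0 / 2 * u by rewrite mulr_gt0.
rewrite If0; lra.
Qed.

End integral_of_continuous.

(** * Strongly continuous semigroups *)

Section semigroup.
Context {R : realType} {E : completeNormedModType R}.
Variable S : R -> {linear_continuous E -> E}.
Hypothesis S_C0 : C0_semigroup S.

Let S0 x : S 0 x = x. Proof. by case: S_C0. Qed.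
Let SD s t x : 0 <= s -> 0 <= t -> S (s + t) x = S s (S t x).
Proof. by case: S_C0 => _ + _ s0 t0; apply. Qed.

Lemma semigroup_near0 x e : 0 < e ->
  exists2 d, 0 < d & forall t, 0 <= t < d -> `|S t x - x| < e.
Proof.
move=> e0; have [_ _ /(_ x) /cvgrPdist_lt /(_ _ e0)] := S_C0.
move=> [d /= d0 dP]; exists d => // t /andP[]; rewrite le_eqVlt.
move=> /predU1P[<- _|t0 td]; first by rewrite S0 subrr normr0.
by rewrite distrC; apply: dP => //=; rewrite sub0r normrN gtr0_norm.
Qed.

(** Otherwise there are times [t n] tending to [0] and operators [S (t n)] of norm
larger than [n], whereas [S (t n) x] converges for each [x]: this contradicts
the uniform boundedness principle. *)
Lemma semigroup_bounded_near0 : exists d M : R, [/\ 0 < d, 1 <= M &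
  forall t x, 0 <= t <= d -> `|S t x| <= M * `|x|].
Proof.
apply: contrapT => nB.
have /choice[t tP] (n : nat) : exists t,
    0 <= t <= n.+1%:R^-1 /\ exists x, n.+1%:R * `|x| < `|S t x|.
  apply: contrapT => /forallNP nt; apply: nB; exists n.+1%:R^-1, n.+1%:R; split.
  - by rewrite invr_gt0.
  - by rewrite ler1n.
  - move=> t x tn; rewrite leNgt; apply/negP => xt.
    by apply: (nt t); split => //; exists x.
have t_ge0 n : 0 <= t n by have [/andP[]] := tP n.
have [] := @Banach_Steinhauss R E E [set f | exists n, f = S (t n) :> (E -> E)] _ _ 1.
- move=> _ [n ->]; split; last by move=> a x y; exact: linearP.
  move=> r; have [C C0 SC] := linear_continuous_bound (S (t n)).
  exists (C * r) => x xr; apply: le_trans (SC x) _.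
  by rewrite ler_wpM2l// ltW.
- move=> x; have [d d0 dP] := semigroup_near0 x ltr01.
  have [N _ NP] : \forall n \near \oo, (n.+1%:R^-1 : R) < d.
    by have /cvgrPdist_lt/(_ _ d0) := @cvg_harmonic R; apply: filterS => n;
      rewrite /= sub0r normrN ger0_norm// invr_ge0.
  exists (\sum_(k < N) `|S (t k) x| + (`|x| + 1)) => _ [n ->].
  have [nN|Nn] := ltnP n N.
    rewrite (bigD1 (Ordinal nN))//= -addrA lerDl addr_ge0 ?sumr_ge0//.
  apply: ler_wpDl; first exact: sumr_ge0.
  rewrite -[S (t n) x](subrK x) addrC.
  apply: le_trans (ler_normD _ _) _; rewrite lerD2l ltW// dP//.
  have [/andP[-> /=] + _] := tP n.
  by move=> /le_lt_trans; apply; exact: NP.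
- move=> M MP.
  pose n := Num.truncn M.
  have Mn : M < n.+1%:R by exact: truncnS_gt.
  have [_ [x xn]] := tP n.
  have x0 : 0 < `|x|.
    rewrite lt_neqAle normr_ge0 andbT eq_sym; apply/negP => /eqP x0.
    move: xn; rewrite x0 mulr0; move/eqP: x0; rewrite normr_eq0 => /eqP ->.
    by rewrite linear0 normr0 ltxx.
  have := MP _ (ex_intro _ n erefl) (`|x|^-1 *: x).
  rewrite linearZ/= !normrZ normfV normr_id mulVf ?gt_eqF// => /(_ (lexx _)).
  rewrite ler_pdivrMl// => H.
  have := lt_le_trans xn H; rewrite mulrC ltr_pM2l// => /(lt_trans Mn).
  by rewrite ltxx.
Qed.

Lemma semigroup_locally_bounded T : exists2 M, 0 < M &
  forall t x, 0 <= t <= T -> `|S t x| <= M * `|x|.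
Proof.
have [d [M [d0 M1 MP]]] := semigroup_bounded_near0.
have M0 : 0 < M by exact: lt_le_trans M1.
have step n t x : 0 <= t <= n%:R * d -> `|S t x| <= M ^+ n * `|x|.
  elim: n t x => [|n IH] t x /andP[t0].
    rewrite mul0r => t0'; have -> : t = 0 by apply/eqP; rewrite eq_le t0' t0.
    by rewrite S0 expr0 mul1r.
  move=> tn; have [td|dt] := leP t d.
    apply: le_trans (MP _ _ _) _; first by rewrite t0.
    by rewrite ler_wpM2r// exprS ler_peMr ?(ltW M0)// exprn_ege1.
  rewrite -(subrK d t) addrC SD ?subr_ge0 ?(ltW d0) ?(ltW dt)//.
  rewrite exprS -mulrA; apply: le_trans (MP _ _ _) _; first by rewrite ltW//= lexx.
  rewrite ler_wpM2l ?(ltW M0)// IH// subr_ge0 (ltW dt)/= lerBlDr.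
  by move: tn; rewrite -natr1 mulrDl mul1r.
exists (M ^+ (Num.truncn (T / d)).+1); first exact: exprn_gt0.
move=> t x /andP[t0 tT]; apply: step; rewrite t0 (le_trans tT)//.
by rewrite -ler_pdivrMr// ltW// truncnS_gt.
Qed.

(** For [u <= v] the increment [S v x - S u x] is the image under [S u] of
[S (v - u) x - x], so that right continuity at [0] gives continuity on both
sides. Clamping the time at [0] turns this into continuity on the whole line. *)
Lemma semigroup_continuous x : continuous (fun t : R => S (Num.max 0 t) x).
Proof.
move=> s; apply/cvgrPdist_lt => e e0.
have [M M0 MP] := semigroup_locally_bounded (Num.max 0 s + 1).
have [d d0 dP] := semigroup_near0 x (divr_gt0 e0 M0).
near=> t.
have m0 u : 0 <= Num.max 0 u :> R by rewrite le_max lexx.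
have key u v : 0 <= u -> 0 <= v -> u <= Num.max 0 s + 1 -> v <= Num.max 0 s + 1 ->
    `|u - v| < d -> `|S u x - S v x| < e.
  wlog uv : u v / u <= v.
    move=> H u0 v0 us vs uvd; have [uv|/ltW vu] := leP u v; first exact: H.
    by rewrite distrC; apply: H => //; rewrite distrC.
  move=> u0 v0 us vs; rewrite distrC ger0_norm ?subr_ge0// => uvd.
  have -> : S v x = S u (S (v - u) x) by rewrite -SD ?subr_ge0// addrC subrK.
  rewrite distrC -linearB; apply: le_lt_trans (MP _ _ _) _; first by rewrite u0.
  by rewrite mulrC -ltr_pdivlMr// dP// subr_ge0 uv.
have ts : `|s - t| < Num.min d 1.
  by near: t; apply: cvgr_dist_lt => //; rewrite lt_min d0 ltr01.
have mts : `|Num.max 0 s - Num.max 0 t| <= `|s - t|.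
  have := ler_norm (s - t); have := ler_norm (t - s); rewrite (distrC t s).
  move: `|s - t| => n ? ?; rewrite ler_norml.
  by have [?|?] := leP 0 s; have [?|?] := leP 0 t; apply/andP; split; lra.
move: ts; rewrite lt_min => /andP[td t1].
apply: key => //.
- by rewrite lerDl.
- have := le_lt_trans mts t1; rewrite ltr_norml => /andP[]; lra.
- exact: le_lt_trans mts td.
Unshelve. all: by end_near. Qed.

Lemma semigroup_continuous2 (f : R -> E) : continuous f ->
  continuous (fun t : R => S (Num.max 0 t) (f t)).
Proof.
move=> cf s; have [M M0 MP] := semigroup_locally_bounded (Num.max 0 s + 1).
apply: (cvg_le_bound (v := fun t : R => M * `|f t - f s| +
    `|S (Num.max 0 t) (f s) - S (Num.max 0 s) (f s)|)).
  near=> t.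
  have ts : Num.max 0 t <= Num.max 0 s + 1.
    have : `|s - t| < 1 by near: t; apply: cvgr_dist_lt.
    rewrite ltr_norml => /andP[s1 s2].
    by have [?|?] := leP 0 s; have [?|?] := leP 0 t; lra.
  have -> : S (Num.max 0 t) (f t) - S (Num.max 0 s) (f s) =
      S (Num.max 0 t) (f t - f s) + (S (Num.max 0 t) (f s) - S (Num.max 0 s) (f s)).
    by rewrite linearB /= addrA subrK.
  apply: le_trans (ler_normD _ _) _; rewrite lerD2r MP//.
  by rewrite le_max lexx.
have c1 : (fun t => `|f t - f s|) @ s --> `|f s - f s|.
  by apply: cvg_norm; apply: cvgB; [exact: cf|exact: cvg_cst].
have c2 : (fun t : R => `|S (Num.max 0 t) (f s) - S (Num.max 0 s) (f s)|) @ s -->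
    `|S (Num.max 0 s) (f s) - S (Num.max 0 s) (f s)|.
  have cs := @semigroup_continuous (f s) s.
  by apply: cvg_norm; apply: cvgB; [exact: cs|exact: cvg_cst].
by have := cvgD (cvgMl_tmp (a := M) c1) c2; rewrite !subrr !normr0 mulr0 addr0; exact.
Unshelve. all: by end_near. Qed.

End semigroup.

(** * The adjoint semigroup *)

Section adjoint_semigroup.
Context {R : realType} {H : completeNormedModType R}.
Variable dot : {dot H for idfun}.
Hypothesis dotE : forall h : H, dot h h = `|h| ^+ 2.
Variable S : R -> {linear_continuous H -> H}.
Hypothesis S_C0 : C0_semigroup S.

Lemma adjoint_norm_le (A A' : H -> H) (M : R) :
  (forall h k, dot (A' h) k = dot h (A k)) -> 0 <= M ->
  (forall k, `|A k| <= M * `|k|) -> forall h, `|A' h| <= M * `|h|.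
Proof.
move=> AA' M0 AM h; apply: (norm_le_dot dotE) => [|k]; first exact: mulr_ge0.
rewrite AA'; apply: le_trans (ler_norm _) _.
apply: le_trans (dot_le dotE _ _) _.
by rewrite (mulrC M) -mulrA ler_wpM2l.
Qed.

Let F h k s := dot h (S (Num.max 0 s) k).

Let F_continuous h k : continuous (F h k).
Proof.
move=> s; apply: (cvg_dot dotE); first exact: cvg_cst.
exact: semigroup_continuous.
Qed.

(** The vector [g] is the integral over [0, d] of the orbit of [h] under the
adjoint semigroup, taken weakly because this orbit is at this stage only known to
be weakly continuous. *)
Lemma weak_average h d : 0 <= d -> exists g, forall k, dot g k = primitive (F h k) d.
Proof.
move=> d0; have [M M0 MP] := semigroup_locally_bounded S_C0 d.
apply: (riesz_representation dotE (C := `|h| * M * d)) => [a x y|k].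
  rewrite -primitive_lin//; apply: eq_primitive => s _.
  by rewrite /F linearP (semiDr (dot_semi dotE)) (semiZr (dot_semi dotE)).
have p0 := primitive0 (F h k).
have := @primitive_increment_le R (F h k) (`|h| * (M * `|k|)) 0 d.
rewrite add0r p0 subr0 => /(_ (@F_continuous _ _) (lexx _) d0) Hle.
apply: le_trans (Hle _) _ => [s sd|]; last first.
  by rewrite le_eqVlt; apply/orP; left; apply/eqP; ring.
apply: le_trans (dot_le dotE _ _) _; rewrite ler_wpM2l// MP//.
by have /andP[/max_idPr -> ->] := sd; rewrite andbT; have /andP[] := sd.
Qed.

Variable T : R -> {linear_continuous H -> H}.
Hypothesis T_adj : forall t h k, dot (T t h) k = dot h (S t k).

Let strong : set H := [set h | T t h @[t --> 0^'+] --> h].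

Let strong_subspace : linear_subspace strong.
Proof.
split=> [|a x y Lx Ly].
  rewrite /strong /=; have -> : (fun t => T t 0) = cst 0 by apply/funext => t; rewrite linear0.
  exact: cvg_cst.
rewrite /strong /=.
have -> : (fun t => T t (a *: x + y)) = (fun t => a *: T t x + T t y).
  by apply/funext => t; rewrite linearP.
by apply: cvgD => //; apply: cvgZl_tmp.
Qed.

(** Tested against [k], the vector [T r g - g] is the difference of the integrals
of [F h k] over [d, d + r] and over [0, r], so that its norm is of order [r]. *)
Let strong_average h d g : 0 <= d -> (forall k, dot g k = primitive (F h k) d) -> strong g.
Proof.
move=> d0 gP; have [M M0 MP] := semigroup_locally_bounded S_C0 (d + 1).
have [_ SD _] := S_C0.
have FK k s : 0 <= s <= d + 1 -> `|F h k s| <= `|h| * (M * `|k|).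
  move=> sd; apply: le_trans (dot_le dotE _ _) _; rewrite ler_wpM2l// MP//.
  by have /andP[/max_idPr -> ->] := sd; rewrite andbT; have /andP[] := sd.
apply: (cvg_le_bound (v := fun r => `|h| * M * 2 * r)); last first.
  rewrite -[X in _ --> X](mulr0 (`|h| * M * 2)); apply: cvgMl_tmp.
  exact: cvg_at_right_filter.
near=> r.
have r0 : 0 < r by [].
have r1 : r <= 1 by near: r; exact: nbhs_right_le.
apply: (norm_le_dot dotE) => [|k].
  by rewrite !mulr_ge0// ltW.
rewrite (semiBl (dot_semi dotE)) T_adj !gP.
have -> : primitive (F h (S r k)) d = primitive (F h k) (d + r) - primitive (F h k) r.
  have <- : 1^-1 * (primitive (F h k) (1 * d + r) - primitive (F h k) r) =
      primitive (F h k) (d + r) - primitive (F h k) r by rewrite invr1 !mul1r.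
  rewrite -primitive_affine// ?(ltW r0)//; apply: eq_primitive => s /andP[s0 _].
  rewrite /F mul1r !(max_idPr _) ?addr_ge0 ?(ltW r0)//.
  by rewrite SD// ltW.
have H1 : `|primitive (F h k) (d + r) - primitive (F h k) d| <= `|h| * (M * `|k|) * r.
  by apply: primitive_increment_le => //; rewrite ?(ltW r0)// => s sd; apply: FK; lra.
have H2 : `|primitive (F h k) (0 + r) - primitive (F h k) 0| <= `|h| * (M * `|k|) * r.
  by apply: primitive_increment_le => //; rewrite ?(ltW r0)// => s sd; apply: FK; lra.
have p0 := primitive0 (F h k).
move: H1 H2; rewrite add0r p0 subr0 !ler_norml => /andP[_ H1] /andP[H2 _].
lra.
Unshelve. all: by end_near. Qed.

(** The inner product of [h] with the average of its own orbit over a short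
interval is close to a positive multiple of [|h| ^+ 2]. *)
Let strong_trivial_orthogonal h : (forall k, strong k -> dot h k = 0) -> h = 0.
Proof.
move=> hL; apply: contrapT => /eqP h0.
have hp : 0 < `|h| ^+ 2 / 2 by rewrite divr_gt0// exprn_gt0// normr_gt0.
have Fh0 : F h h 0 = `|h| ^+ 2.
  by rewrite /F maxxx; have [-> _ _] := S_C0; exact: dotE.
have /cvgrPdist_lt/(_ _ hp)/nbhs_ballP[d /= d0 dP] := @F_continuous h h 0.
have d20 : 0 < d / 2 by rewrite divr_gt0.
have [g gP] := weak_average h (ltW d20).
have := hL g (strong_average (ltW d20) gP).
rewrite (semiC (dot_semi dotE)) gP.
have : primitive (cst (`|h| ^+ 2 / 2)) (d / 2) <= primitive (F h h) (d / 2).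
  apply: le_primitive; [by move=> ?; exact: cvg_cst|exact: F_continuous|].
  move=> s /andP[s0 sd]; have := dP s.
  rewrite -ball_normE /= sub0r normrN ger0_norm// Fh0 => /(_ _)/wrap[]; first lra.
  rewrite ltr_norml => /andP[_]; lra.
rewrite primitive_cst ?(ltW d20)//.
have : 0 < `|h| ^+ 2 / 2 * (d / 2) by rewrite mulr_gt0.
lra.
Qed.

(** The vectors of strong continuity are dense, and the operators [T t] are
uniformly bounded for small [t]. *)
Lemma adjoint_semigroup_C0 : C0_semigroup T.
Proof.
have [S0 SD _] := S_C0; split.
- by move=> h; apply: (dot_ext dotE) => k; rewrite T_adj S0.
- move=> s t s0 t0 h; apply: (dot_ext dotE) => k.
  by rewrite !T_adj addrC SD.
- move=> h; apply/cvgrPdist_lt => e e0.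
  have [M M0 MP] := semigroup_locally_bounded S_C0 1.
  have e'0 : 0 < e / (2 * (M + 1)) by rewrite divr_gt0// mulr_gt0// addr_gt0.
  have [l Ll hl] :=
    approx_of_trivial_orthogonal dotE strong_subspace strong_trivial_orthogonal h e'0.
  have e20 : 0 < e / 2 by rewrite divr_gt0.
  have /cvgrPdist_lt/(_ _ e20) lT := Ll.
  near=> t.
  have t0 : 0 <= t <= 1.
    by apply/andP; split; [exact: ltW|near: t; exact: nbhs_right_le].
  have -> : h - T t h = (h - l) + (l - T t l) + T t (l - h).
    by rewrite linearB /= (addrA (h - l)) subrK addrA subrK.
  apply: le_lt_trans (ler_normD _ _) _.
  apply: le_lt_trans (lerD (ler_normD _ _) (lexx _)) _.
  have Tlh : `|T t (l - h)| <= M * `|h - l|.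
    rewrite distrC; apply: adjoint_norm_le (T_adj t) (ltW M0) _ _ => k.
    exact: MP.
  have lTt : `|l - T t l| < e / 2 by near: t.
  have : `|h - l| * (2 * (M + 1)) < e by rewrite -ltr_pdivlMr// mulr_gt0// addr_gt0.
  lra.
Unshelve. all: by end_near. Qed.

End adjoint_semigroup.

(** * Bochner integrals of continuous functions *)

Section simple_maps.
Context {R : realType}.
Local Notation mu := (@lebesgue_measure R).

Lemma simple_map_comp (V W : normedModType R) (F : V -> W) (g : R -> V) :
  simple_map g -> simple_map (F \o g).
Proof.
move=> [gfin gm]; split.
  by rewrite -(image_comp g F); exact: finite_image.
move=> w; have -> : (F \o g) @^-1` [set w] =
    \bigcup_(v in range g `&` F @^-1` [set w]) (g @^-1` [set v]).
  apply/seteqP; split => [s /= Fw|s [v [_ /= Fv] gsv] /=].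
    by exists (g s) => //; split => //; exists s.
  by rewrite gsv.
apply: fin_bigcup_measurable => [|v _]; last exact: gm.
exact: sub_finite_set gfin.
Qed.

(** On each of the finitely many level sets of [g] the function is a section of
[P]. This avoids the measurability of [P] in both variables. *)
Lemma measurable_simple_section (V : normedModType R) (P : R -> V -> R) (g : R -> V) :
  (forall v, measurable_fun setT (P ^~ v : measurableTypeR R -> measurableTypeR R)) ->
  simple_map g ->
  measurable_fun setT ((fun s => P s (g s)) : measurableTypeR R -> measurableTypeR R).
Proof.
move=> mP [gfin gm] _ Y mY; rewrite setTI.
have -> : (fun s => P s (g s)) @^-1` Y =
    \bigcup_(v in range g) (g @^-1` [set v] `&` (P ^~ v) @^-1` Y).
  apply/seteqP; split => [s /= PY|s [v _ [/= <-]]//].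
  by exists (g s); [exists s|].
apply: fin_bigcup_measurable => // v _; apply: measurableI; first exact: gm.
by rewrite -[X in measurable X]setTI; exact: mP.
Qed.

Variable E : normedModType R.
Implicit Types (y : dual_space E) (g : R -> E).

Lemma simple_map_expand (l : E -> R) g : simple_map g -> forall s,
  l (g s) = \sum_(v <- finmap.enum_fset (fset_set (range g))) l v * \1_(g @^-1` [set v]) s.
Proof.
move=> [gfin _] s.
rewrite (bigD1_seq (g s)) ?finmap.fset_uniq//=; last first.
  by rewrite in_fset_set//; apply/mem_set; exists s.
rewrite indicE mem_set//= mulr1 big1 ?addr0// => v vg.
by rewrite indicE memNset ?mulr0//= => gs; rewrite gs eqxx in vg.
Qed.

(** Vector-valued integrals are identified by functionals: through this lemma the
limits of simple integrals become limits of scalar Lebesgue integrals. *)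
Lemma simple_integral_dual y t g : simple_map g ->
  mu.-integrable `[0, t] (EFin \o (y \o g)) /\
  y (simple_integral t g) = \int[mu]_(s in `[0, t]) y (g s).
Proof.
move=> gs; have [gfin gm] := gs.
have muI : (mu `[0%R, t] < +oo)%E.
  have -> : mu `[0%R, t] = (if (0%:E < t%:E)%E then t%:E - 0%:E else 0)%E.
    exact: (lebesgue_measure_itv `[0, t]).
  by case: ifP => // _; rewrite -EFinB ltry.
have int1 v : mu.-integrable `[0, t] (EFin \o \1_(g @^-1` [set v])).
  apply: measurable_bounded_integrable => //.
  exists 1; split; first exact: num_real.
  by move=> r r1 s _ /=; rewrite indicE ger0_norm//; case: (_ \in _) => /=; lra.
have intg v : mu.-integrable `[0, t] (fun s => (y v)%:E * (\1_(g @^-1` [set v]) s)%:E)%E.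
  by apply: integrableZl => //; exact: int1.
have yE : EFin \o (y \o g) = (fun s => (\sum_(v <- finmap.enum_fset (fset_set (range g)))
    (y v)%:E * (\1_(g @^-1` [set v]) s)%:E)%E).
  apply/funext => s /=; rewrite (simple_map_expand y gs) -sumEFin.
  by apply: eq_bigr => v _; rewrite EFinM.
split; first by rewrite yE; exact: integrable_sum.
rewrite /simple_integral fsbig_finite//= linear_sum /Rintegral.
have -> : (\int[mu]_(s in `[0%R, t]) (y (g s))%:E =
    \int[mu]_(s in `[0%R, t]) (EFin \o (y \o g)) s)%E by [].
rewrite yE integral_sum// -sum_fine => [|v _]; last first.
  exact: integrable_fin_num.
apply: eq_bigr => v _; rewrite linearZ /= integralZl//; last exact: int1.
have -> : (\int[mu]_(s in `[0%R, t]) (\1_(g @^-1` [set v]) s)%:E =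
    mu (g @^-1` [set v] `&` `[0%R, t]))%E by exact: integral_indic.
rewrite fineM//; first by rewrite setIC mulrC.
rewrite ge0_fin_numE// (le_lt_trans _ muI)//; apply: le_measure.
- by apply/mem_set/measurableI.
- exact/mem_set.
- exact: subIsetr.
Qed.

End simple_maps.

Section bochner_continuous.
Import HBNNSimple.
Context {R : realType}.
Local Notation mu := (@lebesgue_measure R).
Implicit Types t : R.

Lemma measurable_norm_sub (E : normedModType R) (f g : R -> E) :
  continuous f -> simple_map g ->
  measurable_fun setT
    ((fun s => `|f s - g s|) : measurableTypeR R -> measurableTypeR R).
Proof.
move=> cf sg.
apply: (@measurable_simple_section _ _ (fun s v => `|f s - v|)) => // v.
apply: measurable_realfun.continuous_measurable_fun => s.
by apply: cvg_norm; apply: cvgB; [exact: cf|exact: cvg_cst].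
Qed.

Lemma simple_integral_dual_le (E : normedModType R) (y : dual_space E) (C : R) t
    (f g : R -> E) :
  0 <= C -> (forall x, `|y x| <= C * `|x|) -> continuous f -> simple_map g ->
  (`|y (simple_integral t g) - primitive (y \o f) t|%:E <=
   C%:E * \int[mu]_(s in `[0%R, t]) (`|f s - g s|%:E))%E.
Proof.
move=> C0 yC cf sg; have [yg ->] := simple_integral_dual y t sg.
have cyf : continuous (y \o f).
  by move=> s; apply: continuous_comp; [exact: cf|exact: cts_fun].
have yf := continuous_itv_integrable 0 t cyf.
have dint : mu.-integrable `[0, t] (EFin \o (fun s => y (g s) - y (f s))).
  apply: (@eq_integrable _ _ _ mu _ _ (fun s => (y (g s))%:E - (y (f s))%:E)%E) => //.
  exact: integrableB.
rewrite /primitive -RintegralB// EFin_normr_Rintegral//.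
have mn := measurable_norm_sub cf sg.
rewrite -ge0_integralZl//; last by apply/measurable_EFinP; exact: measurable_funTS.
apply: le_trans (le_abse_integral _ _ (measurable_int mu dint)) _ => //.
apply: ge0_le_integral => //.
- exact: measurableT_comp (measurable_int mu dint).
- apply/measurable_EFinP; apply: measurable_funM => //; exact: measurable_funTS.
- by move=> s _; rewrite lee_fin -raddfB distrC yC.
Qed.

Lemma bochner_dual (E : normedModType R) (y : dual_space E) t (f : R -> E) (v : E) :
  continuous f -> is_bochner_integral t f v -> y v = primitive (y \o f) t.
Proof.
move=> cf [g [sg _ gf gv]].
have [C C0 yC] := linear_continuous_bound y.
have ygv : y (simple_integral t (g n)) @[n --> \oo] --> y v.
  exact: (@continuous_cvg _ _ _ \oo _ (fun n => simple_integral t (g n)) y v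
    (@cts_fun _ _ y v) gv).
apply: (norm_cvg_unique ygv).
apply/cvgrPdist_lt => e e0.
have eC0 : (0 < (e / C)%:E)%E by rewrite lte_fin divr_gt0.
have : \forall n \near \oo,
    (\int[mu]_(s in `[0%R, t]) (`|f s - g n s|%:E) < (e / C)%:E)%E.
  exact: (gf _ (open_ereal_lt' eC0)).
apply: filterS => n ng; rewrite distrC -lte_fin.
apply: le_lt_trans (simple_integral_dual_le _ (ltW C0) yC cf (sg n)) _.
by rewrite -lte_pdivlMl// -EFinM mulrC.
Qed.

Lemma bochner_linear (V W : normedModType R) (T : {linear_continuous V -> W}) t
   (f : R -> V) v :
  continuous f -> is_bochner_integral t f v -> is_bochner_integral t (T \o f) (T v).
Proof.
move=> cf [g [sg gf intg gv]].
have [C /ltW C0 TC] := linear_continuous_bound T.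
have cTf : continuous (T \o f).
  by move=> s; apply: continuous_comp; [exact: cf|exact: cts_fun].
exists (fun n => T \o g n); split.
- by move=> n; exact: simple_map_comp.
- apply: filterS gf => s gfs s0t.
  exact: (@continuous_cvg _ _ _ \oo _ (fun n => g n s) T (f s)
    (@cts_fun _ _ T (f s)) (gfs s0t)).
- apply: (@squeeze_cvge _ _ _ _ (cst 0%E) _
    (fun n => C%:E * \int[mu]_(s in `[0%R, t]) (`|f s - g n s|%:E))%E).
  + apply: nearW => n; apply/andP; split.
      by apply: integral_ge0 => s _; rewrite lee_fin.
    have mn := measurable_norm_sub cf (sg n).
    have mTn := measurable_norm_sub cTf (simple_map_comp T (sg n)).
    rewrite -ge0_integralZl//; last by apply/measurable_EFinP; exact: measurable_funTS.
    apply: ge0_le_integral => //.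
    * by apply/measurable_EFinP; exact: measurable_funTS.
    * apply/measurable_EFinP; apply: measurable_funM => //; exact: measurable_funTS.
    * by move=> s _; rewrite lee_fin /= -raddfB TC.
  + exact: cvg_cst.
  + rewrite -[X in _ --> X](mule0 C%:E); apply: cvgeZl => //.
- have -> : (fun n => simple_integral t (T \o g n)) =
      (fun n => T (simple_integral t (g n))).
    apply/funext => n; apply: dual_separates => y.
    have [_ ->] := simple_integral_dual y t (simple_map_comp T (sg n)).
    by have [_ <-] := simple_integral_dual (adjoint T y) t (sg n).
  exact: (@continuous_cvg _ _ _ \oo _ (fun n => simple_integral t (g n)) T v
    (@cts_fun _ _ T v) gv).
Qed.

(** Compose [f] with simple functions that increase to the identity on [0, t].
They take values in [0, t], where [f] is bounded, and dominated convergence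
applies. *)
Lemma step_approximation (E : normedModType R) t (f : R -> E) :
  0 <= t -> continuous f -> exists g : nat -> R -> E,
  [/\ forall n, simple_map (g n),
      forall s, 0 <= s <= t -> g n s @[n --> \oo] --> f s &
      (\int[mu]_(s in `[0%R, t]) (`|f s - g n s|%:E))%E @[n --> \oo] --> 0%E].
Proof.
move=> t0 cf.
have mE : measurable_fun (`[0, t]%classic : set (measurableTypeR R))
    (EFin : measurableTypeR R -> \bar R).
  by apply/measurable_EFinP; exact: measurable_id.
(* a sequence of simple functions that increases to the identity on [0, t] *)
pose q := nnsfun_approx (measurable_itv `[0, t]) mE.
have qs n : @simple_map R R^o (q n).
  split; first exact: fimfunP.
  by move=> v; exact: (measurable_funPTI (q n) (measurable_set1 v)).
have q_cvg s : 0 <= s <= t -> q n s @[n --> \oo] --> s.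
  move=> st; have sD : (`[0, t]%classic : set R) s by rewrite /= in_itv.
  have E0 u : (`[0, t]%classic : set R) u -> (0 <= u%:E)%E.
    by rewrite /= in_itv /= => /andP[u0 _]; rewrite lee_fin.
  have /fine_cvg := cvg_nnsfun_approx (measurable_itv `[0, t]) mE E0 sD.
  exact.
have q_itv n s : 0 <= s <= t -> 0 <= q n s <= t.
  move=> st; have qc := q_cvg s st; apply/andP; split; first exact: fun_ge0.
  have qnd : nondecreasing_seq (fun n => q n s).
    by move=> m k mk; exact/lefP/nd_nnsfun_approx.
  have := nondecreasing_cvgn_le qnd (cvgP _ qc) n.
  rewrite (cvg_lim _ qc)// => /le_trans; apply; by case/andP: st.
have cnf : continuous (fun s => `|f s|) by move=> s; apply: cvg_norm; exact: cf.
have [c _ cM] := EVT_max t0 (continuous_subspaceT cnf).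
exists (fun n => f \o q n); split.
- by move=> n; exact: (@simple_map_comp R R^o E f _ (qs n)).
- move=> s st; exact: (@continuous_cvg _ _ _ \oo _ (fun n => q n s) f s
    (cf s) (q_cvg s st)).
- have -> : 0%E = (\int[mu]_(s in `[0%R, t]) (cst 0 s))%E by rewrite integral0.
  apply: (@dominated_cvg _ _ _ mu _ _ _ _ (cst (2 * `|f c|)%:E)) => //.
  + move=> n; apply/measurable_EFinP; apply: measurable_funTS.
    exact: measurable_norm_sub cf (@simple_map_comp R R^o E f _ (qs n)).
  + move=> s; rewrite /= in_itv /= => st.
    apply/fine_cvgP; split; first exact: nearW.
    have -> : 0 = `|f s - f s| by rewrite subrr normr0.
    apply: cvg_norm; apply: cvgB; first exact: cvg_cst.
    exact: (@continuous_cvg _ _ _ \oo _ (fun n => q n s) f s (cf s) (q_cvg s st)).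
  + apply: (@continuous_itv_integrable _ (cst (2 * `|f c|))).
    by move=> ?; exact: cvg_cst.
  + move=> n s; rewrite /= in_itv /= => st.
    rewrite lee_fin normr_id; apply: le_trans (ler_normB _ _) _.
    have := cM s; have := cM (q n s); rewrite !in_itv /= => /(_ (q_itv n s st)) H1 /(_ st) H2.
    lra.
Qed.

(** The integral [v] is obtained weakly, from the Riesz theorem. For the strong
convergence of the simple integrals, the error is tested against itself. *)
Lemma bochner_exists (H : completeNormedModType R) (dot : {dot H for idfun})
    (dotE : forall h : H, dot h h = `|h| ^+ 2) t (f : R -> H) :
  0 <= t -> continuous f -> exists v, is_bochner_integral t f v.
Proof.
move=> t0 cf; have [g [sg gf intg]] := step_approximation t0 cf.
have cdf k : continuous (fun s => dot (f s) k).
  by move=> s; apply: (cvg_dot dotE); [exact: cf|exact: cvg_cst].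
have cnf : continuous (fun s => `|f s|) by move=> s; apply: cvg_norm; exact: cf.
have [c _ cM] := EVT_max t0 (continuous_subspaceT cnf).
have [|k|v vP] := riesz_representation dotE
    (f := fun k => primitive (fun s => dot (f s) k) t) (C := `|f c| * t).
- move=> a x y; rewrite -primitive_lin//; apply: eq_primitive => s _.
  by rewrite (semiDr (dot_semi dotE)) (semiZr (dot_semi dotE)).
- have p0 := primitive0 (fun s => dot (f s) k).
  have := @primitive_increment_le R _ (`|f c| * `|k|) 0 t (cdf k) (lexx _) t0.
  rewrite add0r p0 subr0 => Hle; rewrite mulrAC; apply: Hle => s st.
  apply: le_trans (dot_le dotE _ _) _; rewrite ler_wpM2r//.
  by apply: cM; rewrite in_itv.
exists v, g; split => //.
  by apply: aeW => s; rewrite in_itv /=; exact: gf.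
have dint n : (`|simple_integral t (g n) - v|%:E <=
    \int[mu]_(s in `[0%R, t]) (`|f s - g n s|%:E))%E.
  set w := _ - v; have [->|w0] := eqVneq w 0.
    by rewrite normr0; apply: integral_ge0 => s _; rewrite lee_fin.
  have wp : 0 < `|w| by rewrite normr_gt0.
  have [y yP] : exists y : dual_space H, forall k, y k = dot k w.
    apply: (@linear_continuous_of_bound R H R^o (fun k => dot k w) `|w|).
      by move=> a x z; rewrite (semiPl (dot_semi dotE)).
    by move=> k; rewrite mulrC dot_le.
  have yb k : `|y k| <= `|w| * `|k| by rewrite yP mulrC dot_le.
  have := @simple_integral_dual_le H y `|w| t f (g n) (normr_ge0 _) yb cf (sg n).
  have -> : primitive (y \o f) t = dot v w.
    by rewrite vP; apply: eq_primitive => s _ /=; rewrite yP.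
  rewrite yP -(semiBl (dot_semi dotE)) -/w dotE normrX normr_id expr2 EFinM.
  by rewrite lee_pmul2l.
apply/cvgrPdist_lt => e e0.
have e0' : (0%:E < e%:E)%E by rewrite lte_fin.
have : \forall n \near \oo, (\int[mu]_(s in `[0%R, t]) (`|f s - g n s|%:E) < e%:E)%E.
  exact: (intg _ (open_ereal_lt' e0')).
apply: filterS => n ne; rewrite distrC -lte_fin.
exact: le_lt_trans (dint n) ne.
Qed.

(** The integrand of [Q t] is only under control at nonnegative times. *)
Lemma eq_bochner_integral (V : normedModType R) t (f g : R -> V) :
  (forall s, 0 <= s <= t -> f s = g s) -> bochner_integral t f = bochner_integral t g.
Proof.
move=> fg; rewrite /bochner_integral; congr (xget _ _).
have sub (f1 g1 : R -> V) : (forall s, 0 <= s <= t -> f1 s = g1 s) ->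
    [set v | is_bochner_integral t f1 v] `<=` [set v | is_bochner_integral t g1 v].
  move=> fg1 v [u [us uf intu uv]]; exists u; split => //.
    by apply: filterS uf => s us1 st; rewrite -fg1; [exact: us1|move: st; rewrite in_itv].
  rewrite (_ : (fun n => _) = (fun n => \int[lebesgue_measure]_(s in `[0%R, t])
    (`|f1 s - u n s|%:E))%E)//.
  apply/funext => n; apply: eq_integral => s; rewrite inE /= in_itv /= => st.
  by rewrite fg1.
by apply/seteqP; split; apply: sub => // s /fg.
Qed.

Lemma bochner_integral_eq (V : normedModType R) t (f : R -> V) v :
  continuous f -> is_bochner_integral t f v -> bochner_integral t f = v.
Proof.
move=> cf fv; apply: xget_unique => // w fw; apply: dual_separates => y.
by rewrite (bochner_dual y cf fv) (bochner_dual y cf fw).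
Qed.

End bochner_continuous.

(** * The reproducing kernel Hilbert spaces *)

Section restricted_semigroup.
Context {R : realType} {E H : completeNormedModType R}.
Variable dot : {dot H for idfun}.
Hypothesis dotE : forall h : H, dot h h = `|h| ^+ 2.
Variable i : {linear_continuous H -> E}.
Hypothesis i_inj : injective i.

Local Notation j := (hilbert_adjoint dot i).

Lemma hilbert_adjointP x k : dot (j x) k = x (i k).
Proof.
have [C _ xC] := linear_continuous_bound x.
have [D _ iD] := linear_continuous_bound i.
have [h hP] := @riesz_representation _ _ _ dotE (fun k => x (i k)) (`|C| * D)
  ltac:(by move=> a u v; rewrite !linearP)
  ltac:(move=> u; apply: le_trans (xC _) _; rewrite -mulrA;
        apply: le_trans (ler_wpM2r (normr_ge0 _) (ler_norm C)) _;
        by rewrite ler_wpM2l).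
have := @xgetPex _ 0 [set h | forall k, dot h k = adjoint i x k].
by move=> /(_ (ex_intro _ h hP)) /(_ k).
Qed.

Lemma range_hilbert_adjoint_subspace : linear_subspace (range j).
Proof.
have lin a (x y : dual_space E) : exists z : dual_space E, forall v, z v = a * x v + y v.
  have [C C0 xC] := linear_continuous_bound x.
  have [D D0 yD] := linear_continuous_bound y.
  apply: (@linear_continuous_of_bound R E R^o (fun v => a * x v + y v) (`|a| * C + D)).
      move=> b u v; rewrite !dual_lin /GRing.scale /=; ring.
  move=> v; rewrite mulrDl; apply: le_trans (ler_normD _ _) _.
  by rewrite normrM -mulrA lerD// ler_wpM2l.
have jlin a x y : range j (a *: j x + j y).
  have [z zP] := lin a x y; exists z => //.
  apply: (dot_ext dotE) => k.
  by rewrite (semiPl (dot_semi dotE)) !hilbert_adjointP zP.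
split; last by move=> a _ _ [x _ <-] [y _ <-].
have [x _] := @hahn_banach R E 0.
by have := jlin (-1) x x; rewrite scaleN1r addNr.
Qed.

(** If [h] is orthogonal to the range of [j], every functional vanishes at [i h]. *)
Lemma range_hilbert_adjoint_orthogonal h :
  (forall k, range j k -> dot h k = 0) -> h = 0.
Proof.
move=> hj; apply: i_inj; apply: dual_separates => x.
rewrite !linear0 -hilbert_adjointP (semiC (dot_semi dotE)).
by apply: hj; exists x.
Qed.

Lemma eq_hilbert_adjoint h h' :
  (forall k, range j k -> dot h k = dot h' k) -> h = h'.
Proof.
move=> hh; apply/eqP; rewrite -subr_eq0; apply/eqP.
apply: range_hilbert_adjoint_orthogonal => k jk.
by rewrite (semiBl (dot_semi dotE)) hh// subrr.
Qed.

Variable S : R -> {linear_continuous E -> E}.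
Variable SH : R -> {linear_continuous H -> H}.
Hypothesis S_SH : restricts_to i S SH.
Variable T : R -> {linear_continuous H -> H}.
Hypothesis T_adj : forall t h k, dot (T t h) k = dot h (SH t k).

Let SH_C0 : C0_semigroup SH. Proof. by case: S_SH. Qed.
Let T_C0 : C0_semigroup T. Proof. exact: (adjoint_semigroup_C0 dotE SH_C0 T_adj). Qed.

Local Notation Q := (integrated_covariance S (cov_operator dot i)).

(** The operator [Q t] factors as [i \o G \o j], where [dot (G h) k = gram t h k].
The clamping of the time makes the integrand
continuous on the whole line. *)
Definition gram (t : R) (h k : H) : R :=
  primitive (fun s => dot (T (Num.max 0 s) h) (T (Num.max 0 s) k)) t.

Let gram_integrand_continuous h k :
  continuous (fun s : R => dot (T (Num.max 0 s) h) (T (Num.max 0 s) k)).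
Proof. by move=> s; apply: (cvg_dot dotE); exact: semigroup_continuous. Qed.

Lemma gram_semi t : semi_inner (gram t).
Proof.
split=> [h k|a h k l|h].
- by apply: eq_primitive => s _; rewrite (semiC (dot_semi dotE)).
- rewrite -primitive_lin//; apply: eq_primitive => s _.
  by rewrite linearP (semiPl (dot_semi dotE)).
- by apply: Rintegral_ge0 => s _; exact: semi_ge0 (dot_semi dotE) _.
Qed.

Local Notation N t := (seminorm_of (gram t)).

Lemma gram_seminorm_le t : 0 <= t ->
  exists2 K, 0 < K & forall k, N t k <= K * `|k|.
Proof.
move=> t0; have [M M0 MP] := semigroup_locally_bounded T_C0 t.
exists (Num.sqrt (M ^+ 2 * (t + 1))) => [|k].
  by rewrite sqrtr_gt0 mulr_gt0 ?exprn_gt0// ltr_wpDl.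
have -> : Num.sqrt (M ^+ 2 * (t + 1)) * `|k| = Num.sqrt (M ^+ 2 * (t + 1) * `|k| ^+ 2).
  have p : 0 <= M ^+ 2 * (t + 1) by rewrite mulr_ge0 ?sqr_ge0// addr_ge0.
  by rewrite (sqrtrM _ p) sqrtr_sqr normr_id.
apply: ler_wsqrtr.
have : gram t k k <= primitive (cst (M ^+ 2 * `|k| ^+ 2)) t.
  apply: le_primitive => //; first by move=> ?; exact: cvg_cst.
  move=> s /andP[s0 st]; rewrite dotE -exprMn ler_sqr ?nnegrE ?mulr_ge0 ?(ltW M0)//.
  by rewrite MP// le_max lexx/= ge_max t0.
rewrite primitive_cst// => /le_trans; apply.
have : 0 <= M ^+ 2 * `|k| ^+ 2 by rewrite mulr_ge0 ?sqr_ge0.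
lra.
Qed.

Lemma gram_riesz t h : 0 <= t -> exists w, forall k, dot w k = gram t h k.
Proof.
move=> t0; have [K K0 KP] := gram_seminorm_le t0.
apply: (riesz_representation dotE (C := N t h * K)) => [a x y|k].
  by rewrite (semiDr (gram_semi t)) (semiZr (gram_semi t)).
apply: le_trans (cauchy_schwarz (gram_semi t) _ _) _.
by rewrite -mulrA ler_wpM2l ?seminorm_ge0.
Qed.

(** On [0, t] the integrand is [i (SH s (T s (j x)))], because
[j (adjoint (S s) x) = T s (j x)]; its integral is the image under [i] of an
integral in [H]. *)
Lemma integrated_covarianceE t x : 0 <= t ->
  exists2 w, Q t x = i w & forall k, dot w k = gram t (j x) k.
Proof.
move=> t0; have [iS _] := S_SH.
pose f (s : R) := SH (Num.max 0 s) (T (Num.max 0 s) (j x)).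
have cf : continuous f.
  apply: (semigroup_continuous2 SH_C0); exact: (semigroup_continuous T_C0).
have [w fw] := bochner_exists dotE t0 cf.
have cif : continuous (i \o f).
  by move=> s; apply: continuous_comp; [exact: cf|exact: cts_fun].
exists w => [|k].
  rewrite -(bochner_integral_eq cif (bochner_linear i cf fw)).
  apply: eq_bochner_integral => s /andP[s0 _].
  rewrite /f /= (max_idPr s0) iS//; congr (S s (i _)).
  apply: (dot_ext dotE) => k; rewrite hilbert_adjointP T_adj hilbert_adjointP /=.
  by rewrite iS.
have [y yP] := @linear_continuous_of_bound R H R^o (fun h => dot h k) `|k|
  ltac:(by move=> a u v; rewrite (semiPl (dot_semi dotE)))
  ltac:(by move=> u; rewrite mulrC; exact: dot_le).
rewrite -yP (bochner_dual y cf fw); apply: eq_primitive => s _ /=.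
by rewrite yP /f (semiC (dot_semi dotE)) -T_adj (semiC (dot_semi dotE)).
Qed.

Lemma dual_integrated_covariance t (x y : dual_space E) : 0 <= t ->
  y (Q t x) = gram t (j x) (j y).
Proof.
move=> t0; have [w -> wP] := integrated_covarianceE x t0.
by rewrite -hilbert_adjointP (semiC (dot_semi dotE)) wP.
Qed.

Lemma range_norm_gram t x : 0 <= t -> range_norm (Q t) x = N t (j x).
Proof. by move=> t0; rewrite /range_norm dual_integrated_covariance. Qed.

Lemma range_dist_gram t x y : 0 <= t -> range_dist (Q t) x y = N t (j x - j y).
Proof.
move=> t0; rewrite /range_dist /seminorm_of; congr Num.sqrt.
rewrite (dualB x) (dualB y).
transitivity (gram t (j x) (j x) - gram t (j y) (j x) -
    (gram t (j x) (j y) - gram t (j y) (j y))).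
  by congr (_ - _ - (_ - _)); exact: dual_integrated_covariance.
by rewrite (semiBl (gram_semi t)) !(semiBr (gram_semi t)) (semiC (gram_semi t) (j y)); ring.
Qed.

(** The seminorm of [gram t] controls the norm of the vector [w] that represents
[gram t v], so that these vectors converge in [H] when [v] is Cauchy for
[gram t]. *)
Lemma gram_cauchy_limit t (v : nat -> H) : 0 <= t -> semi_cauchy (gram t) v ->
  exists h, [/\ forall k, gram t (v n) k @[n --> \oo] --> (dot h k : R) &
    forall w, (forall n k, dot (w n) k = gram t (v n) k) -> w n @[n --> \oo] --> h].
Proof.
move=> t0 vC; have [K K0 KP] := gram_seminorm_le t0.
have /choice[w wP] n := gram_riesz (v n) t0.
have : cvgn w.
  apply: cauchy_seq_cvg => e e0; apply: filterS (vC _ (divr_gt0 e0 K0)) => -[m n] /=.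
  rewrite ltr_pdivlMr//; apply: le_lt_trans.
  apply: (norm_le_dot dotE) => [|k]; first by rewrite mulr_ge0 ?seminorm_ge0 ?ltW.
  rewrite (semiBl (dot_semi dotE)) !wP -(semiBl (gram_semi t)).
  apply: le_trans (ler_norm _) _.
  apply: le_trans (cauchy_schwarz (gram_semi t) _ _) _.
  by rewrite -mulrA ler_wpM2l ?seminorm_ge0.
move=> /cvg_ex[/= h wh]; exists h; split => [k|w' w'P].
  have : dot (w n) k @[n --> \oo] --> (dot h k : R).
    by apply: (cvg_dot dotE) => //; exact: cvg_cst.
  by under eq_fun do rewrite wP.
suff -> : w' = w by [].
by apply/funext => n; apply: (dot_ext dotE) => k; rewrite wP w'P.
Qed.

Lemma rkhs_rep_gram t u z : 0 <= t -> rkhs_rep (Q t) u z ->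
  exists h, [/\ z = i h, semi_cauchy (gram t) (j \o u) &
    forall k, gram t (j (u n)) k @[n --> \oo] --> (dot h k : R)].
Proof.
move=> t0 [uC uz].
have juC : semi_cauchy (gram t) (j \o u).
  move=> e e0; apply: filterS (uC e e0) => -[m n] /=.
  by rewrite range_dist_gram.
have [h [hP hw]] := gram_cauchy_limit t0 juC.
exists h; split => //.
have /choice[w wP] n : exists w, Q t (u n) = i w /\ forall k, dot w k = gram t (j (u n)) k.
  by have [w] := integrated_covarianceE (u n) t0; exists w.
have wh : w n @[n --> \oo] --> h by apply: hw => n k; have [] := wP n.
have iwh : i (w n) @[n --> \oo] --> i h.
  exact: (@continuous_cvg _ _ _ \oo _ w i h (@cts_fun _ _ i h) wh).
apply: (norm_cvg_unique uz).
rewrite (_ : (fun n => Q t (u n)) = (fun n => i (w n)))//.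
by apply/funext => n; have [] := wP n.
Qed.

(** Only vectors [k] in the range of [j] are tested, as these are the ones which
occur in the completion that defines the RKHS. *)
Definition gram_dominated t h C := forall k, range j k -> `|dot h k| <= C * N t k.

(** The domination makes [dot h] a bounded functional on the range of [j] with the
seminorm of [gram t]; a sequence representing it is sent by [Q t] to a sequence
that converges to [i h]. *)
Lemma rkhs_of_gram_dominated t h C : 0 <= t -> gram_dominated t h C -> rkhs (Q t) (i h).
Proof.
move=> t0 hC.
have hlin a x y : dot h (a *: x + y) = a * dot h x + dot h y.
  by rewrite (semiDr (dot_semi dotE)) (semiZr (dot_semi dotE)).
have [v [vj vC vh]] :=
  semi_riesz_sequence (gram_semi t) range_hilbert_adjoint_subspace hlin hC.
have /choice[u uv] n : exists x, j x = v n by have [x _ xv] := vj n; exists x.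
have [g [gP gw]] := gram_cauchy_limit t0 vC.
have gh : g = h.
  apply: eq_hilbert_adjoint => k jk; exact: (norm_cvg_unique (gP k) (vh k jk)).
exists u; split.
  move=> e e0; apply: filterS (vC e e0) => -[m n] /=.
  by rewrite range_dist_gram// !uv.
have /choice[w wP] n : exists w, Q t (u n) = i w /\ forall k, dot w k = gram t (v n) k.
  by have [w] := integrated_covarianceE (u n) t0; rewrite uv; exists w.
rewrite (_ : (fun n => Q t (u n)) = (fun n => i (w n))); last first.
  by apply/funext => n; have [] := wP n.
have wh : w n @[n --> \oo] --> h by rewrite -gh; apply: gw => n k; have [] := wP n.
exact: (@continuous_cvg _ _ _ \oo _ w i h (@cts_fun _ _ i h) wh).
Qed.

(** Every sequence that represents [z] represents the functional [dot h] as well,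
and the limit of its norms is the norm of this functional. *)
Lemma rkhs_norm_gram t z : 0 <= t -> rkhs (Q t) z ->
  exists h, [/\ z = i h, 0 <= rkhs_norm (Q t) z,
    gram_dominated t h (rkhs_norm (Q t) z) &
    forall C, 0 <= C -> gram_dominated t h C -> rkhs_norm (Q t) z <= C].
Proof.
move=> t0 [u uz].
have normP u' : rkhs_rep (Q t) u' z -> exists2 h, z = i h & exists r,
    [/\ range_norm (Q t) (u' n) @[n --> \oo] --> r, 0 <= r, gram_dominated t h r &
    forall C, 0 <= C -> gram_dominated t h C -> r <= C].
  move=> u'z; have [h [zh uC uh]] := rkhs_rep_gram t0 u'z.
  exists h => //.
  have [||r [ur r0 rdom rmin]] :=
    semi_cauchy_norm (gram_semi t) (D := range j) _ uC (l := dot h).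
  - by move=> n; exists (u' n).
  - by move=> k _; exact: uh.
  exists r; split => //.
  by under eq_fun do rewrite range_norm_gram//.
have [h _ [r [ur _ _ _]]] := normP u uz.
have [u' u'z u'r] := xgetPex 0 (ex_intro
  [set r | exists2 u, rkhs_rep (Q t) u z & range_norm (Q t) (u n) @[n --> \oo] --> r]
  r (ex_intro2 _ _ u uz ur)).
have [h' zh' [r' [ur' r'0 r'dom r'min]]] := normP u' u'z.
exists h'; rewrite /rkhs_norm.
by have -> := norm_cvg_unique u'r ur'.
Qed.


Lemma gram_mono t s k : 0 <= t -> t <= s -> N t k <= N s k.
Proof.
move=> t0 ts; apply: ler_wsqrtr; rewrite -subr_ge0 primitiveB ?t0//.
by apply: Rintegral_ge0 => u _; exact: semi_ge0 (dot_semi dotE) _.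
Qed.

(** The forms increase with the time. Conversely, for [s <= t] and [u] in [0, t],
[T u] factors through [T (s / t * u)] with a bounded left factor, and the change
of variables [u |-> s / t * u] maps [0, t] to [0, s]. *)
Lemma gram_comparison t s : 0 < t -> 0 < s ->
  exists2 C, 0 < C & forall k, N t k <= C * N s k.
Proof.
move=> t0 s0; have [ts|/ltW st] := leP t s.
  by exists 1 => // k; rewrite mul1r; exact: gram_mono (ltW t0) ts.
have [_ TD _] := T_C0.
have [M M0 MP] := semigroup_locally_bounded T_C0 t.
exists (Num.sqrt (M ^+ 2 * (t / s))) => [|k].
  by rewrite sqrtr_gt0 mulr_gt0 ?exprn_gt0// divr_gt0.
rewrite -sqrtrM; last by rewrite mulr_ge0 ?sqr_ge0// divr_ge0 ?ltW.
apply: ler_wsqrtr.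
pose F (u : R) := dot (T (Num.max 0 u) k) (T (Num.max 0 u) k).
have cF : continuous F by exact: gram_integrand_continuous.
have c0 : 0 < s / t by rewrite divr_gt0.
have cG : continuous (fun u => F (s / t * u + 0)).
  move=> u; apply: (@continuous_comp _ _ _ (fun u : R => s / t * u + 0) F); last exact: cF.
  by apply: cvgD; [exact: cvgMl_tmp|exact: cvg_cst].
have cM : continuous (fun u => M ^+ 2 * F (s / t * u + 0) + 0).
  by move=> u; apply: cvgD; [apply: cvgMl_tmp; exact: cG|exact: cvg_cst].
have : gram t k k <= primitive (fun u => M ^+ 2 * F (s / t * u + 0) + cst 0 u) t.
  apply: le_primitive => // u /andP[u0 ut].
  have su : 0 <= s / t * u by rewrite mulr_ge0 ?(ltW c0).
  have su1 : s / t * u <= u by rewrite ler_piMl// ler_pdivrMr// mul1r.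
  rewrite /F !addr0 !(max_idPr _)// !dotE -exprMn ler_sqr ?nnegrE ?mulr_ge0 ?(ltW M0)//.
  have -> : T u k = T (u - s / t * u) (T (s / t * u) k).
    by rewrite -TD ?subr_ge0// subrK.
  by rewrite MP// subr_ge0 su1 lerBlDr (le_trans ut)// lerDl.
rewrite primitive_lin//; last by move=> ?; exact: cvg_cst.
rewrite primitive_affine ?(ltW t0)// primitive_cst ?(ltW t0)// mul0r !addr0.
by rewrite primitive0 subr0 divfK ?gt_eqF// invf_div mulrA.
Qed.

Lemma rkhs_subset_range t : 0 <= t -> rkhs (Q t) `<=` range i.
Proof.
by move=> t0 z /(rkhs_norm_gram t0)[h [-> _ _ _]]; exists h.
Qed.

Lemma rkhs_comparison t s : 0 < t -> 0 < s -> rkhs (Q t) `<=` rkhs (Q s) /\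
  exists2 C, 0 < C & forall z, rkhs (Q t) z -> rkhs_norm (Q s) z <= C * rkhs_norm (Q t) z.
Proof.
move=> t0 s0; have [C C0 NC] := gram_comparison t0 s0.
have dom h r : 0 <= r -> gram_dominated t h r -> gram_dominated s h (C * r).
  move=> r0 hr k jk; apply: le_trans (hr k jk) _.
  by rewrite mulrAC mulrC ler_wpM2r.
have sub : rkhs (Q t) `<=` rkhs (Q s).
  move=> z /(rkhs_norm_gram (ltW t0))[h [-> r0 hr _]].
  exact: rkhs_of_gram_dominated (ltW s0) (dom _ _ r0 hr).
split => //; exists C => // z zt.
have [h [zh r0 hr _]] := rkhs_norm_gram (ltW t0) zt.
have [h' [zh' _ _ hmin]] := rkhs_norm_gram (ltW s0) (sub z zt).
have hh : h' = h by apply: i_inj; rewrite -zh -zh'.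
by apply: hmin; [rewrite mulr_ge0 ?(ltW C0)|rewrite hh; exact: dom].
Qed.

(** The RKHS contains the vectors [Q t x], that is the [i w] with
[dot w l = gram t (j x) l]. A vector [l] orthogonal to all these [w] satisfies
[gram t l l = 0]. *)
Lemma rkhs_dense t : 0 < t -> dense (i @^-1` rkhs (Q t)).
Proof.
move=> t0; have t0' := ltW t0.
apply: (dense_of_trivial_orthogonal dotE).
  split.
    apply: (rkhs_of_gram_dominated (C := 0)) => // k _.
    by rewrite (semi0l (dot_semi dotE)) normr0 mul0r.
  move=> a x y /(rkhs_norm_gram t0')[x' [/i_inj <- _ xr _]].
  move=> /(rkhs_norm_gram t0')[y' [/i_inj <- _ yr _]].
  apply: (rkhs_of_gram_dominated
    (C := `|a| * rkhs_norm (Q t) (i x) + rkhs_norm (Q t) (i y))) => // k jk.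
  rewrite (semiPl (dot_semi dotE)); apply: le_trans (ler_normD _ _) _.
  by rewrite normrM mulrDl -mulrA lerD ?ler_wpM2l ?xr ?yr.
move=> l lD.
have [w wP] := gram_riesz l t0'.
have w0 : w = 0.
  apply: range_hilbert_adjoint_orthogonal => _ [x _ <-].
  have [v Qv vP] := integrated_covarianceE x t0'.
  rewrite wP (semiC (gram_semi t)) -vP (semiC (dot_semi dotE)); apply: lD.
  apply: (rkhs_of_gram_dominated (C := N t (j x))) => // k _.
  by rewrite vP; exact: cauchy_schwarz (gram_semi t) _ _.
have := primitive_ge0_continuous_eq0 (@gram_integrand_continuous l l) t0
  (fun s => semi_ge0 (dot_semi dotE) _).
rewrite -/(gram t l l) -wP w0 (semi0l (dot_semi dotE)) maxxx => /(_ erefl).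
have [T0 _ _] := T_C0; rewrite T0 dotE => /eqP.
by rewrite sqrf_eq0 normr_eq0 => /eqP.
Qed.

(** For [s] in [0, t] one has [|T t k| <= m * |T s k|], as [T t = T (t - s) \o T s];
the average of the squares over [s] bounds [t * |T t k| ^+ 2] by
[m ^+ 2 * gram t k k]. *)
Lemma semigroup_maps_into_rkhs t m : 0 < t -> 0 <= m ->
  (forall r h, 0 < r <= t -> `|SH r h| <= m * `|h|) ->
  forall h, rkhs (Q t) (S t (i h)) /\
    Num.sqrt t * rkhs_norm (Q t) (S t (i h)) <= m * `|h|.
Proof.
move=> t0 m0 SHm h; have t0' := ltW t0.
have [iS _] := S_SH; have [T0 TD Tc] := T_C0.
have Tm r k : 0 < r <= t -> `|T r k| <= m * `|k|.
  by move=> rt; apply: (adjoint_norm_le dotE (T_adj r) m0) => k'; exact: SHm.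
(* The bound extends to r = 0 by strong continuity; this covers the endpoint
   s = t of the integration below. *)
have Tm0 r k : 0 <= r <= t -> `|T r k| <= m * `|k|.
  move=> /andP[]; rewrite le_eqVlt => /predU1P[<- _|r0 rt]; last by rewrite Tm// r0.
  rewrite T0; have /cvg_norm Tk := Tc k.
  apply: (ler_cvg_to Tk (cvg_cst (m * `|k|))).
  near=> r'; apply: Tm; apply/andP; split => //.
  by near: r'; exact: nbhs_right_le.
have sqrt_t : 0 < Num.sqrt t by rewrite sqrtr_gt0.
have key k : Num.sqrt t * `|T t k| <= m * N t k.
  rewrite -ler_sqr ?nnegrE ?mulr_ge0 ?(ltW sqrt_t) ?seminorm_ge0//.
  rewrite !exprMn (seminorm_sqr (gram_semi t)) sqr_sqrtr//.
  have -> : t * `|T t k| ^+ 2 = primitive (cst (`|T t k| ^+ 2)) t.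
    by rewrite primitive_cst// mulrC.
  have -> : m ^+ 2 * gram t k k = primitive (fun s =>
      m ^+ 2 * dot (T (Num.max 0 s) k) (T (Num.max 0 s) k) + cst 0 s) t.
    rewrite primitive_lin//; last by move=> ?; exact: cvg_cst.
    by rewrite primitive_cst// mul0r addr0.
  apply: le_primitive; first by move=> ?; exact: cvg_cst.
    move=> s; apply: cvgD; last exact: cvg_cst.
    apply: cvgMl_tmp; exact: gram_integrand_continuous.
  move=> s /andP[s0 st].
  rewrite /= addr0 (max_idPr s0) dotE -exprMn ler_sqr ?nnegrE ?mulr_ge0//.
  have -> : T t k = T (t - s) (T s k) by rewrite -TD ?subr_ge0// subrK.
  by apply: Tm0; rewrite subr_ge0 st lerBlDr lerDl.
have dom : gram_dominated t (SH t h) (m * `|h| / Num.sqrt t).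
  move=> k _; rewrite (semiC (dot_semi dotE)) -T_adj.
  apply: le_trans (dot_le dotE _ _) _.
  rewrite mulrAC ler_pdivlMr// mulrC mulrA -(mulrC (N t k)).
  by have := ler_wpM2r (normr_ge0 h) (key k); rewrite mulrA; lra.
rewrite -iS//; have rk := rkhs_of_gram_dominated t0' dom.
split => //; have [h' [/i_inj <- _ _ hmin]] := rkhs_norm_gram t0' rk.
rewrite mulrC -ler_pdivlMr//; apply: hmin dom.
by rewrite divr_ge0 ?mulr_ge0 ?(ltW sqrt_t).
Unshelve. all: by end_near. Qed.

End restricted_semigroup.

(** * Operator norms and limits superior *)

Lemma operator_norm_le (R : realType) (V : normedModType R) (T : Type) (n : T -> R)
    (f : V -> T) (C : R) : 0 <= C -> (forall v, n (f v) <= C * `|v|) ->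
  (operator_norm n f <= C%:E)%E.
Proof.
move=> C0 fC; apply: ge_ereal_sup => _ [v v1 <-]; rewrite lee_fin.
by apply: le_trans (fC v) _; rewrite ler_piMr.
Qed.

Lemma le_operator_norm (R : realType) (V W : normedModType R)
    (f : {linear_continuous V -> W}) (C : R) :
  (operator_norm Num.norm f <= C%:E)%E -> forall v, `|f v| <= C * `|v|.
Proof.
move=> fC v; have [->|v0] := eqVneq v 0; first by rewrite linear0 !normr0 mulr0.
have vp : 0 < `|v| by rewrite normr_gt0.
rewrite -ler_pdivrMr// mulrC -{1}(ger0_norm (ltW vp)) -normfV -normrZ -linearZ.
rewrite -lee_fin; apply: le_trans fC; apply: ereal_sup_ubound.
exists (`|v|^-1 *: v) => //=.
by rewrite normrZ normfV normr_id mulVf ?gt_eqF.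
Qed.

Lemma operator_norm_ge0 (R : realType) (V W : normedModType R)
    (f : {linear_continuous V -> W}) : (0 <= operator_norm Num.norm f)%E.
Proof.
apply: ereal_sup_ubound; exists 0; first by rewrite /= normr0.
by rewrite linear0 normr0.
Qed.

Theorem theorem3p5 (R : realType) (E H : completeNormedModType R)
    (dot : {dot H for idfun}) (dotE : forall h : H, dot h h = `|h| ^+ 2)
    (i : {linear_continuous H -> E}) (i_inj : injective i)
    (S : R -> {linear_continuous E -> E}) (S_C0 : C0_semigroup S)
    (SH : R -> {linear_continuous H -> H}) (S_SH : restricts_to i S SH) :
  let Q := integrated_covariance S (cov_operator dot i) in
  [/\ forall t s : R, 0 < t -> 0 < s ->
        rkhs (Q t) = rkhs (Q s) /\
        equivalent_norms (rkhs (Q t)) (rkhs_norm (Q t)) (rkhs_norm (Q s)),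
      forall t : R, 0 < t ->
        rkhs (Q t) `<=` range i /\ dense (i @^-1` rkhs (Q t)) &
      [/\ forall t : R, 0 < t ->
            S t @` range i `<=` rkhs (Q t),
          (* S t is bounded from H to H_t *)
          forall t : R, 0 < t ->
            (operator_norm (rkhs_norm (Q t)) (fun h : H => S t (i h)) < +oo)%E &
          (limf_esup (fun t : R => (Num.sqrt t)%:E *
             operator_norm (rkhs_norm (Q t)) (fun h : H => S t (i h))) 0^'+
           <= limf_esup (fun t : R => operator_norm Num.norm (SH t)) 0^'+)%E]].
Proof.
move=> Q; have [_ SH_C0] := S_SH.
have /choice[T T_adj] t := adjoint_operator dotE (SH t).
have smoothing := semigroup_maps_into_rkhs dotE i_inj S_SH T_adj.
have norm_le t m : 0 < t -> 0 <= m ->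
    (forall r h, 0 < r <= t -> `|SH r h| <= m * `|h|) ->
    (operator_norm (rkhs_norm (Q t)) (fun h : H => S t (i h)) <= (m / Num.sqrt t)%:E)%E.
  move=> t0 m0 SHm; apply: operator_norm_le; first by rewrite divr_ge0.
  move=> h; have [_] := smoothing t m t0 m0 SHm h.
  by rewrite mulrAC ler_pdivlMr ?sqrtr_gt0// mulrC.
split.
- move=> t s t0 s0.
  have [ts [C C0 NC]] := rkhs_comparison dotE i_inj S_SH T_adj t0 s0.
  have [st [D D0 ND]] := rkhs_comparison dotE i_inj S_SH T_adj s0 t0.
  split; first by apply/seteqP; split; [exact: ts|exact: st].
  exists D^-1, C; split=> [||z zt]; [by rewrite invr_gt0|exact: C0|].
  apply/andP; split; last exact: NC.
  by rewrite mulrC ler_pdivrMr// mulrC; exact: (ND z (ts z zt)).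
- move=> t t0; split.
    exact: (rkhs_subset_range dotE S_SH T_adj (ltW t0)).
  exact: (rkhs_dense dotE i_inj S_SH T_adj t0).
split.
- move=> t t0 _ [_ [h _ <-] <-].
  have [M M0 MP] := semigroup_locally_bounded SH_C0 t.
  have [] := smoothing t M t0 (ltW M0) _ h => // r k /andP[r0 rt].
  by apply: MP; rewrite ltW.
- move=> t t0.
  have [M M0 MP] := semigroup_locally_bounded SH_C0 t.
  apply: (@le_lt_trans _ _ (M / Num.sqrt t)%:E); last by rewrite ltry.
  apply: norm_le => //; first exact: ltW.
  by move=> r h /andP[r0 rt]; apply: MP; rewrite ltW.
apply: le_ereal_inf_tmp => _ [V V0 <-].
have [d /= d0 dV] := V0.
(* A whole interval ]0, d[ lies in V, so that one constant m bounds SH on ]0, t]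
   for all t < d. *)
have Vd r : 0 < r < d -> V r.
  by move=> /andP[r0 rd]; apply: dV => //=; rewrite sub0r normrN gtr0_norm.
set m := ereal_sup _.
have mV r : 0 < r < d -> (operator_norm Num.norm (SH r) <= m)%E.
  by move=> rd; apply: ereal_sup_ubound; exists r => //; exact: Vd.
have d20 : 0 < d / 2 < d by rewrite divr_gt0//= ltr_pdivrMr// ltr_pMr// ltr1n.
have m0 : (0 <= m)%E.
  exact: le_trans (operator_norm_ge0 _) (mV _ d20).
case: m m0 mV => [m| |] // m0 mV; last by rewrite leey.
rewrite lee_fin in m0.
apply: le_trans (ereal_inf_lbound _) _.
  exists [set r | 0 < r < d] => //.
  exists d => // r; rewrite /= sub0r normrN => rd r0.
  by rewrite r0 -(gtr0_norm r0).
apply: ge_ereal_sup => _ [t /= /andP[t0 td] <-].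
have sqrt_t : 0 < Num.sqrt t by rewrite sqrtr_gt0.
have -> : m%:E = ((Num.sqrt t)%:E * (m / Num.sqrt t)%:E)%E.
  by rewrite -EFinM mulrC divfK ?gt_eqF.
rewrite lee_pmul2l//; apply: norm_le => // r h /andP[r0 rt].
by apply: le_operator_norm; apply: mV; rewrite r0 (le_lt_trans rt td).
Qed.
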